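(* Let $n,m\ge 1$, $d=n+m$, $\rho\ge 0$, $\mu=[\mu_x^\top,\mu_y^\top]^\top$ with $\mu_x\in\mathbb R^n$, $\mu_y\in\mathbb R^m$, let $\Sigma$ be a symmetric positive definite $d\times d$ matrix, $\mathbb P=\mathcal N_d(\mu,\Sigma)$, and $\underline\sigma=\lambda_{\min}(\Sigma)>0$. Let $\mathcal P=\{\mathbb Q\text{ a normal distribution on }\mathbb R^d: W_2(\mathbb Q,\mathbb P)\le\rho\}$ and let $\mathcal L$ be the family of all measurable functions from $\mathbb R^m$ to $\mathbb R^n$. Then the minimax problem $$\inf_{\psi\in\mathcal L}\ \sup_{\mathbb Q\in\mathcal P}\ \mathbb E^{\mathbb Q}\big[\|x-\psi(y)\|^2\big]\qquad (\mathrm{M})$$ is equivalent to (that is, has the same optimal value as) the finite-dimensional convex program $$\begin{aligned}\sup\quad & \mathrm{Tr}\big[S_{xx}-S_{xy}S_{yy}^{-1}S_{yx}\big]\\ \text{s.t.}\quad & S=\begin{bmatrix}S_{xx}&S_{xy}\\S_{yx}&S_{yy}\end{bmatrix}\in\mathbb S_+^d,\quad S_{xx}\in\mathbb S_+^n,\quad S_{yy}\in\mathbb S_+^m,\quad S_{xy}=S_{yx}^\top\in\mathbb R^{n\times m},\\ & \mathrm{Tr}\Big[S+\Sigma-2\big(\Sigma^{1/2}S\Sigma^{1/2}\big)^{1/2}\Big]\le\rho^2,\qquad S\succeq\underline\sigma I_d\end{aligned}\qquad (\mathrm{D})$$ (whose objective function is concave on its convex feasible set). Moreover, if $S^\star$,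 with blocks $S^\star_{xx},S^\star_{yy},S^\star_{xy}$, is optimal in (D), then the affine function $$\psi^\star(y)=S^\star_{xy}(S^\star_{yy})^{-1}(y-\mu_y)+\mu_x$$ is the distributionally robust minimum mean square error estimator, and the normal distribution $\mathbb Q^\star=\mathcal N_d(\mu,S^\star)$ is the least favorable prior.
   Context: $\mathbb S_+^k$ is the cone of symmetric positive semidefinite $k\times k$ matrices; $A\succeq B$ means $A-B$ is positive semidefinite; $I_d$ is the identity. $\mathbb E^{\mathbb Q}$ denotes expectation when $z=[x^\top,y^\top]^\top$, with $x\in\mathbb R^n$ and $y\in\mathbb R^m$, has distribution $\mathbb Q$. Normal distributions may have any positive semidefinite covariance matrix. The type-2 Wasserstein distance between distributions $\mathbb Q_1,\mathbb Q_2$ on $\mathbb R^d$ is $$W_2(\mathbb Q_1,\mathbb Q_2)=\inf_{\pi\in\Pi(\mathbb Q_1,\mathbb Q_2)}\Big(\int\|z_1-z_2\|^2\,\pi(dz_1,dz_2)\Big)^{1/2},$$ where $\Pi(\mathbb Q_1,\mathbb Q_2)$ is the set of probability distributions on $\mathbb R^d\times\mathbb R^d$ with marginals $\mathbb Q_1,\mathbb Q_2$. A distributionally robust minimum mean square error estimator is a $\psi\in\mathcal L$ that solves the outer minimization problem in (M), i.e. minimizes $\sup_{\mathbb Q\in\mathcal P}\mathbb E^{\mathbb Q}[\|x-\psi(y)\|^2]$ over $\psi\in\mathcal L$. A least favorable prior is a $\mathbb Q\in\mathcal P$ that solves the dual problem $\sup_{\mathbb Q\in\mathcal P}\inf_{\psi\in\mathcal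 L}\mathbb E^{\mathbb Q}[\|x-\psi(y)\|^2]$, i.e. attains its outer supremum. *)

(* Defs.v *)
From HB Require Import structures.
From mathcomp Require Import all_boot all_order all_algebra.
From mathcomp Require Import all_classical all_reals all_analysis.
From mathcomp Require Import measurable_realfun.

Set Implicit Arguments.
Unset Strict Implicit.
Unset Printing Implicit Defensive.

Import Order.TTheory GRing.Theory Num.Theory.
Import numFieldNormedType.Exports.

Local Open Scope classical_set_scope.
Local Open Scope ring_scope.

(* Matrices over R carry the sigma-algebra generated by the coordinate maps
   (as n.-tuple R does in the library); on 'cV[R]_d this is the usual Borel
   sigma-algebra of R^d. *)
Definition measure_matrix_display : measure_display.
Proof. by constructor. Qed.

Section matrix_measurable.
Variables (R : realType) (m n : nat).

Definition matrix_cylinder : set (set 'M[R]_(m, n)) :=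
  [set A | exists i j (B : set R),
     measurable B /\ A = (fun M : 'M[R]_(m, n) => M i j) @^-1` B].

Let matrix_meas0 : <<s matrix_cylinder >> set0.
Proof. exact: sigma_algebra0. Qed.

Let matrix_measC A : <<s matrix_cylinder >> A -> <<s matrix_cylinder >> (~` A).
Proof. exact: sigma_algebraC. Qed.

Let matrix_meas_bigcup (F : (set 'M[R]_(m, n))^nat) :
  (forall i, <<s matrix_cylinder >> (F i)) ->
  <<s matrix_cylinder >> (\bigcup_i (F i)).
Proof. exact: sigma_algebra_bigcup. Qed.

HB.instance Definition _ := @isMeasurable.Build measure_matrix_display
  'M[R]_(m, n) <<s matrix_cylinder >> matrix_meas0 matrix_measC
  matrix_meas_bigcup.

Lemma measurable_entry (i : 'I_m) (j : 'I_n) :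
  measurable_fun [set: 'M[R]_(m, n)] (fun M : 'M[R]_(m, n) => M i j).
Proof.
move=> _ B mB; rewrite setTI; apply: sub_sigma_algebra.
by exists i, j, B.
Qed.

Lemma measurable_fun_mx d (T : measurableType d) (f : T -> 'M[R]_(m, n)) :
  (forall i j, measurable_fun [set: T] (fun x => f x i j)) ->
  measurable_fun [set: T] f.
Proof.
move=> mf; apply: (@measurability _ _ _ _ _ _ matrix_cylinder) => //.
by move=> _ [_ [i [j [B [mB ->]]]] <-]; exact: mf.
Qed.

End matrix_measurable.

Section linear_algebra.
Variable R : realType.

Definition sqnorm2 d (v : 'cV[R]_d) : R := \sum_i v i 0 ^+ 2.

Definition psd d (A : 'M[R]_d) : Prop :=
  A^T = A /\ forall v : 'cV[R]_d, 0 <= (v^T *m A *m v) 0 0.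

Definition posdef d (A : 'M[R]_d) : Prop :=
  A^T = A /\ forall v : 'cV[R]_d, v != 0 -> 0 < (v^T *m A *m v) 0 0.

Definition loewner_ge d (A B : 'M[R]_d) : Prop := psd (A - B).

(* The positive semidefinite square root; meaningful only if A is psd. *)
Definition psd_sqrt d (A : 'M[R]_d) : 'M[R]_d :=
  xget 0 [set B | psd B /\ B *m B = A].

(* A symmetric matrix with d >= 1 has a nonempty finite set of real
   eigenvalues, so the infimum is their minimum. *)
Definition lambda_min d (A : 'M[R]_d) : R := inf [set a | eigenvalue A a].

End linear_algebra.

Section normal_distribution.
Variable R : realType.

Definition consv d (p : measurableTypeR R * 'cV[R]_d) : 'cV[R]_d.+1 :=
  col_mx (const_mx p.1 : 'cV[R]_1) p.2.

Lemma measurable_consv d : measurable_fun setT (@consv d).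
Proof.
apply: measurable_fun_mx => i j; rewrite /consv /=.
have [k ->|k ->] := split_ordP (i : 'I_(1 + d)).
  rewrite [X in measurable_fun _ X](_ : _ = fst) ?ord1; first exact: measurable_fst.
  by apply/funext => x; rewrite (@col_mxEu _ 1 d 1) mxE.
rewrite [X in measurable_fun _ X](_ : _ = (fun M : 'cV_d => M k j) \o snd).
  exact: (measurableT_comp (measurable_entry k j) measurable_snd).
by apply/funext => x; rewrite (@col_mxEd _ 1 d 1).
Qed.

HB.instance Definition _ d :=
  isMeasurableFun.Build _ _ _ _ (@consv d) (@measurable_consv d).

Definition affinev d (mu : 'cV[R]_d) (A : 'M[R]_d) (z : 'cV[R]_d) : 'cV[R]_d :=
  mu + A *m z.

Lemma measurable_affinev d (mu : 'cV[R]_d) (A : 'M[R]_d) :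
  measurable_fun setT (affinev mu A).
Proof.
apply: measurable_fun_mx => i j; rewrite /affinev /=.
under eq_fun do rewrite !mxE.
apply: measurable_funD => //; apply: measurable_sum => k.
by apply: measurable_funM => //; exact: measurable_entry.
Qed.

HB.instance Definition _ d (mu : 'cV[R]_d) (A : 'M[R]_d) :=
  isMeasurableFun.Build _ _ _ _ (affinev mu A) (measurable_affinev mu A).

(* The d-fold product of N(0, 1). *)
Fixpoint std_normal d : probability 'cV[R]_d R :=
  match d with
  | 0 => \d_(0 : 'cV[R]_0)
  | d'.+1 => distribution (normal_prob (0 : R) 1 \x std_normal d')%E (@consv d')
  end.

(* The law of mu + S^(1/2) Z with Z standard normal, which is N_d(mu, S) for
   every psd S, singular ones included.  (The library's univariate
   normal_prob m 0 is not the Dirac mass at m, so N_d(mu, S) should not be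
   specified through it when S is singular.) *)
Definition normal_law d (mu : 'cV[R]_d) (S : 'M[R]_d) : probability 'cV[R]_d R :=
  distribution (std_normal d) (affinev mu (psd_sqrt S)).

(* Measures are functions on all sets, so only values on measurable sets are
   compared. *)
Definition is_normal d (Q : probability 'cV[R]_d R) : Prop :=
  exists (mu : 'cV[R]_d) (S : 'M[R]_d),
    psd S /\ forall A, measurable A -> Q A = normal_law mu S A.

End normal_distribution.

Section wasserstein.
Variables (R : realType) (d : nat).
Implicit Types Q P : probability 'cV[R]_d R.

Definition coupling Q1 Q2 : set (probability ('cV[R]_d * 'cV[R]_d)%type R) :=
  [set pi | (forall A, measurable A -> pi (A `*` setT) = Q1 A) /\
            (forall A, measurable A -> pi (setT `*` A) = Q2 A)].

Definition W2 Q1 Q2 : \bar R :=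
  ereal_inf [set ((\int[pi]_z (sqnorm2 (z.1 - z.2))%:E) `^ 2^-1)%E
            | pi in coupling Q1 Q2].

Definition normal_ball P (rho : R) : set (probability 'cV[R]_d R) :=
  [set Q | is_normal Q /\ (W2 Q P <= rho%:E)%E].

End wasserstein.

Section estimation.
Variables (R : realType) (n m : nat).
Implicit Types (psi : 'cV[R]_m -> 'cV[R]_n).
Implicit Types (Q : probability 'cV[R]_(n + m) R).
Implicit Types (PP : set (probability 'cV[R]_(n + m) R)).

(* z = [x; y], x = usubmx z, y = dsubmx z *)
Definition mse Q psi : \bar R :=
  'E_Q[fun z => sqnorm2 (usubmx z - psi (dsubmx z))]%E.

Definition estimators : set ('cV[R]_m -> 'cV[R]_n) :=
  [set psi | measurable_fun setT psi].

Definition worst_mse PP psi : \bar R := ereal_sup [set mse Q psi | Q in PP].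

Definition minimax_value PP : \bar R :=
  ereal_inf [set worst_mse PP psi | psi in estimators].

Definition best_mse Q : \bar R := ereal_inf [set mse Q psi | psi in estimators].

Definition dr_mmse_estimator PP psi : Prop :=
  estimators psi /\
  forall phi, estimators phi -> (worst_mse PP psi <= worst_mse PP phi)%E.

Definition least_favorable_prior PP Q : Prop :=
  PP Q /\ forall Q', PP Q' -> (best_mse Q' <= best_mse Q)%E.

End estimation.

Section program.
Variables (R : realType) (n m : nat).
Implicit Types S Sigma : 'M[R]_(n + m).

(* Blocks of S: xx = ulsubmx, xy = ursubmx, yx = dlsubmx, yy = drsubmx. *)
Definition D_objective S : R :=
  \tr (ulsubmx S - ursubmx S *m invmx (drsubmx S) *m dlsubmx S).

Definition D_feasible Sigma (rho : R) : set 'M[R]_(n + m) :=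
  [set S | [/\ psd S, psd (ulsubmx S), psd (drsubmx S),
     ursubmx S = (dlsubmx S)^T &
     \tr (S + Sigma -
          2 *: psd_sqrt (psd_sqrt Sigma *m S *m psd_sqrt Sigma)) <= rho ^+ 2
     /\ loewner_ge S (lambda_min Sigma)%:M]].

Definition D_value Sigma (rho : R) : \bar R :=
  ereal_sup [set (D_objective S)%:E | S in D_feasible Sigma rho].

Definition D_optimal Sigma (rho : R) S : Prop :=
  D_feasible Sigma rho S /\
  forall S', D_feasible Sigma rho S' -> D_objective S' <= D_objective S.

End program.

Definition concave_function (R : realType) (E : lmodType R) (D : set E)
  (f : E -> R) : Prop := @convex_function R E D (fun x => - f x).

(* Main.v *)
From HB Require Import structures.
Require Import Defs.
From mathcomp Require Import all_boot all_order all_algebra.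
From mathcomp Require Import all_classical all_reals all_analysis.
From mathcomp Require Import measurable_realfun.
From mathcomp Require Import ring lra.
From mathcomp Require complex spectral.

Set Implicit Arguments.
Unset Strict Implicit.
Unset Printing Implicit Defensive.

Import Order.TTheory GRing.Theory Num.Theory.
Import numFieldNormedType.Exports.

Local Open Scope classical_set_scope.
Local Open Scope ring_scope.

(* For an affine estimator [psi(y) = A (y - mu_y) + mu_x] put [B := [I, -A]], so
   that the error is [B (z - mu)] and its mean square under [N(mu, S)] is
   [tr (B S B^T)]; the objective of (D) is the minimum of this over [A].

   Lower bound.  For [S] positive definite and [A] the regression matrix of [S],
   flipping the sign of the error while keeping [y] fixed preserves [N(mu, S)],
   so no measurable estimator beats the objective of (D) at [S].  The normal law
   [N(mu, S)] lies in the ball when [S] is feasible: a factor [X X^T = S] gives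
   the coupling [(mu + X Z, mu + Sigma^(1/2) Z)] of the right cost.  Both facts
   only use that the law of [X Z] depends on [X X^T], that is, that the standard
   normal law is invariant under the orthogonal group.

   Upper bound.  In an eigenbasis [u_i] of [B^T B] with eigenvalues [l_i], the
   mean square error under [Q] is the sum of [l_i a_i^2] with [a_i] the [L^2(Q)]
   norm of [u_i . (z - mu)].  If [s_i] is the same norm under [P], then every
   coupling costs at least the sum of the [(a_i - s_i)^2], so
   [t_i := max (a_i - s_i, 0)] has [\sum t_i^2 <= rho^2], and the sum of the
   [l_i (s_i + t_i)^2] is [tr (B S B^T)] for [S := L Sigma L], where [L >= I]
   scales [u_i] by [1 + t_i / s_i]; this [S] is feasible for (D).  Hence the
   worst case over the ball is at most the maximum of the linear functional
   [tr (B S B^T)] over the feasible set.  For the regression matrix of a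
   (nearly) optimal [S0] this maximum is (nearly) the objective at [S0], by
   first-order optimality along segments.  Nearly optimal [S0] suffice for the
   equality of the values, so existence of an optimum is not needed. *)

(** * Orthogonal matrices and the spectral theorem *)

Lemma trmxB (V : zmodType) m n (A B : 'M[V]_(m, n)) : (A - B)^T = A^T - B^T.
Proof. exact: raddfB. Qed.

Lemma trmxZ (S : pzRingType) m n (a : S) (A : 'M[S]_(m, n)) :
  (a *: A)^T = a *: A^T.
Proof. exact: linearZ. Qed.

Section orthogonal.
Variable R : realType.

Lemma sqnorm2E d (v : 'cV[R]_d) : sqnorm2 v = (v^T *m v) 0 0.
Proof. by rewrite /sqnorm2 mxE; apply: eq_bigr => i _; rewrite mxE expr2. Qed.

Lemma sqnorm2_ge0 d (v : 'cV[R]_d) : 0 <= sqnorm2 v.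
Proof. by apply: sumr_ge0 => i _; rewrite sqr_ge0. Qed.

Lemma sqnorm2_eq0 d (v : 'cV[R]_d) : (sqnorm2 v == 0) = (v == 0).
Proof.
rewrite /sqnorm2 psumr_eq0 => [|i _]; last exact: sqr_ge0.
apply/allP/eqP => [v0|-> i _]; last by rewrite mxE expr0n eqxx.
apply/colP => i; rewrite mxE; apply/eqP; rewrite -sqrf_eq0.
by apply: v0; rewrite mem_index_enum.
Qed.

Lemma sqnorm2_gt0 d (v : 'cV[R]_d) : (0 < sqnorm2 v) = (v != 0).
Proof. by rewrite lt_neqAle sqnorm2_ge0 eq_sym sqnorm2_eq0 andbT. Qed.

Lemma orthogonal_trK d (O : 'M[R]_d) : O *m O^T = 1%:M -> O^T *m O = 1%:M.
Proof. exact: mulmx1C. Qed.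

Lemma sqnorm2_orthogonal d (O : 'M[R]_d) (v : 'cV_d) :
  O *m O^T = 1%:M -> sqnorm2 (O *m v) = sqnorm2 v.
Proof.
move=> /orthogonal_trK OO; rewrite !sqnorm2E trmx_mul -mulmxA (mulmxA _ O) OO.
by rewrite mul1mx.
Qed.

(** The reflection along [w = v - r e] exchanges [v] and [r e], which have equal length. It deflates
    an eigenvector in the spectral theorem and turns linear forms or columns onto the first axis. *)
Lemma householder d (v : 'cV[R]_d.+1) : exists2 O : 'M[R]_d.+1,
  O *m O^T = 1%:M & O *m v = Num.sqrt (sqnorm2 v) *: delta_mx 0 0.
Proof.
set r := Num.sqrt _; set e : 'cV[R]_d.+1 := delta_mx 0 0.
have r2 : r * r = sqnorm2 v by rewrite -expr2 sqr_sqrtr ?sqnorm2_ge0.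
pose w := v - r *: e.
have [w0|w0] := eqVneq w 0.
  exists 1%:M; first by rewrite trmx1 mul1mx.
  by rewrite mul1mx; apply/eqP; rewrite -subr_eq0; apply/eqP.
have ve : (v^T *m e) 0 0 = v 0 0 by rewrite -colE !mxE.
have ev : (e^T *m v) 0 0 = v 0 0 by rewrite trmx_delta -rowE mxE.
have ee : (e^T *m e) 0 0 = 1 by rewrite trmx_delta mul_delta_mx mxE !eqxx.
(* Equal lengths of [v] and [r e] give this; it makes the reflection subtract exactly one copy of
   [w] from [v]. *)
have Nw : sqnorm2 w = 2 * (w^T *m v) 0 0.
rewrite sqnorm2E /w trmxB trmxZ mulmxBr !mulmxBl -!scalemxAl -!scalemxAr.
  do ! rewrite [((_ + _ : matrix _ _ _) _ _)]mxE
     || rewrite [((- _ : matrix _ _ _) _ _)]mxE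
     || rewrite [((_ *: _ : matrix _ _ _) _ _)]mxE.
  rewrite -sqnorm2E ve ev ee mulr1 r2; ring.
have vBw : v - w = r *: e by rewrite /w opprB addrC subrK.
clearbody w; have Nw0 : sqnorm2 w != 0 by rewrite sqnorm2_eq0.
have ww : w^T *m w = (sqnorm2 w)%:M by rewrite sqnorm2E -mx11_scalar.
pose k := 2 / sqnorm2 w.
have PP : w *m w^T *m (w *m w^T) = sqnorm2 w *: (w *m w^T).
  by rewrite mulmxA -(mulmxA w) ww mul_mx_scalar scalemxAl.
have kk : k * k * sqnorm2 w = k + k by rewrite /k; field.
exists (1%:M - k *: (w *m w^T)).
  rewrite trmxB trmxZ trmx1 trmx_mul trmxK mulmxBl mul1mx -scalemxAl mulmxBr.
  rewrite mulmx1 -scalemxAr PP scalerBr !scalerA kk scalerDl.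
  by rewrite opprB addrK subrK.
rewrite mulmxBl mul1mx -scalemxAl -mulmxA (mx11_scalar (w^T *m v)) mul_mx_scalar.
rewrite scalerA (_ : k * _ = 1) ?scale1r//.
by rewrite /k Nw; field; apply: contra Nw0; rewrite Nw => /eqP ->; rewrite mulr0.
Qed.

End orthogonal.

(** * Diagonalization of real symmetric matrices *)

Section spectral.
Variable R : realType.

Import (canonicals) complex.
Import spectral.

(** Over the complex closure an eigenvalue exists. It is a quotient of values of Hermitian forms,
    hence real, and being an eigenvalue descends to the real matrix. *)
Lemma symmetric_eigenvector d (A : 'M[R]_d.+1) : A^T = A ->
  exists a (v : 'cV[R]_d.+1), v != 0 /\ A *m v = a *: v.
Proof.
move=> AT; pose C : numClosedFieldType := complex.complex R.
pose f : {rmorphism R -> C} := complex.real_complex R.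
have fJ (x : R) : Num.conj (f x) = f x by exact: complex.conjc_real.
have [a eig_a] := eigenvalue_closed (map_mx f A) isT.
have [v vA v0] := eigenvalueP eig_a.
pose w := map_mx Num.conj v^T.
have ww_gt0 : 0 < (v *m w) 0 0 by rewrite /w -dotmxE; exact: dotmx_is_dotmx.
have a_real : a \is Num.real.
  have -> : a = (v *m map_mx f A *m w) 0 0 / (v *m w) 0 0.
    by rewrite vA -scalemxAl mxE mulfK ?gt_eqF.
  rewrite rpred_div// ?(gtr0_real ww_gt0)//; apply/CrealP.
  have fA : map_mx Num.conj (map_mx f A) = map_mx f A.
    by rewrite -map_mx_comp; apply/matrixP => i j; rewrite !mxE /= fJ.
  transitivity ((map_mx Num.conj (v *m map_mx f A *m w)) 0 0); first by rewrite [RHS]mxE.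
  have wJ : map_mx Num.conj w = v^T.
    by apply/matrixP => i j; rewrite !mxE conjCK.
  have vJ : map_mx Num.conj v = w^T by rewrite /w map_trmx trmxK.
  have fAT : (map_mx f A)^T = map_mx f A by rewrite map_trmx AT.
  by rewrite !map_mxM fA wJ vJ -[in LHS]fAT -!trmx_mul [LHS]mxE mulmxA.
have [b aE] := complex.complex_realP (a : complex.complex R) a_real.
move: eig_a; rewrite aE eigenvalue_map => /eigenvalueP[u uA u0].
exists b, u^T; split; first by rewrite trmx_eq0.
by rewrite -[A in LHS]AT -trmx_mul uA trmxZ.
Qed.

(** Deflation: once an eigenvector is turned onto the first axis, the first column of the conjugated
    matrix is a multiple of that axis, and symmetry makes the matrix block diagonal. *)
Lemma spectral_symmetric d (A : 'M[R]_d) : A^T = A ->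
  exists (U : 'M[R]_d) (l : 'rV[R]_d),
    U *m U^T = 1%:M /\ A = U^T *m diag_mx l *m U.
Proof.
elim: d A => [|d IHd] A AT.
  by exists 1%:M, 0; split; apply/matrixP => -[].
have [a [v [v0 Av]]] : exists a (v : 'cV[R]_d.+1), v != 0 /\ A *m v = a *: v.
  exact: symmetric_eigenvector.
have [ O OO Ov] := householder v.
set r := Num.sqrt _ in Ov.
have r0 : r != 0 by rewrite sqrtr_eq0 -ltNge sqnorm2_gt0.
have OtO := orthogonal_trK OO.
pose B : 'M[R]_(1 + d) := O *m A *m O^T.
have BT : B^T = B by rewrite /B !trmx_mul trmxK AT mulmxA.
have Be : B *m (delta_mx 0 0 : 'cV_(1 + d)) = a *: delta_mx 0 0.
  apply: (scalerI r0); rewrite [LHS]scalemxAr -Ov /B -!mulmxA (mulmxA O^T) OtO.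
  by rewrite mul1mx Av -scalemxAr Ov scalerA mulrC -scalerA.
have AE : A = O^T *m B *m O.
  by rewrite /B !mulmxA OtO mul1mx -mulmxA OtO mulmx1.
clearbody B; have Be_entry i : B i (lshift d 0) = a * (i == lshift d 0)%:R.
  have <- : 0 = lshift d 0 :> 'I_(1 + d) by apply/val_inj.
  by have /colP/(_ i) := Be; rewrite -colE !mxE eqxx andbT.
have B11 : ulsubmx B = a%:M.
  by apply/matrixP => i j; rewrite !ord1 !mxE Be_entry eqxx mulr1n mulr1.
have B21 : dlsubmx B = 0.
  by apply/matrixP => i j; rewrite ord1 !mxE Be_entry eq_rlshift mulr0.
have [U' [l' [UU' BE]]] : exists (U : 'M[R]_d) (l : 'rV[R]_d),
    U *m U^T = 1%:M /\ drsubmx B = U^T *m diag_mx l *m U.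
  by apply: IHd; rewrite trmx_drsub BT.
have B12 : ursubmx B = 0 by rewrite -(trmxK (ursubmx B)) trmx_ursub BT B21 trmx0.
have EB : B = block_mx a%:M 0 0 (U'^T *m diag_mx l' *m U').
  by rewrite -(submxK B) B11 B12 B21 BE.
pose V : 'M[R]_(1 + d) := block_mx 1%:M 0 0 U'.
have VV : V *m V^T = 1%:M.
  rewrite /V tr_block_mx mulmx_block !trmx1 !trmx0 !mulmx0 !mul0mx mulmx1 UU'.
  by rewrite !addr0 add0r -scalar_mx_block.
have BV : B = V^T *m diag_mx (row_mx a%:M l') *m V.
  rewrite EB /V tr_block_mx !trmx1 !trmx0 diag_mx_row !mulmx_block.
  rewrite !mulmx0 !mul0mx !addr0 !add0r mul1mx !mulmx1 mul0mx; congr block_mx.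
  by apply/matrixP => i j; rewrite !ord1 !mxE.
exists (V *m O); exists (row_mx a%:M l'); split.
  by rewrite trmx_mul mulmxA -(mulmxA V) OO mulmx1.
by rewrite AE trmx_mul [in LHS]BV !mulmxA.
Qed.

End spectral.

(** * Positive semidefinite matrices *)

Section psd_theory.
Variable R : realType.

Lemma psd0 d : psd (0 : 'M[R]_d).
Proof. by split=> [|v]; rewrite ?trmx0// mulmx0 mul0mx mxE. Qed.

Lemma psdD d (A B : 'M[R]_d) : psd A -> psd B -> psd (A + B).
Proof.
move=> [AT A0] [BT B0]; split=> [|v]; first by rewrite linearD /= AT BT.
by rewrite mulmxDr mulmxDl mxE addr_ge0.
Qed.

Lemma psdZ d a (A : 'M[R]_d) : 0 <= a -> psd A -> psd (a *: A).
Proof.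
move=> a0 [AT A0]; split=> [|v]; first by rewrite trmxZ AT.
by rewrite -scalemxAr -scalemxAl mxE mulr_ge0.
Qed.

Lemma psd_congr d e (C : 'M[R]_(d, e)) (A : 'M[R]_e) :
  psd A -> psd (C *m A *m C^T).
Proof.
move=> [AT A0]; split=> [|v]; first by rewrite !trmx_mul trmxK AT mulmxA.
by have := A0 (C^T *m v); rewrite trmx_mul trmxK !mulmxA.
Qed.

Lemma psd1 d : psd (1%:M : 'M[R]_d).
Proof. by split=> [|v]; rewrite ?trmx1// mulmx1 -sqnorm2E sqnorm2_ge0. Qed.

Lemma psd_gram d e (C : 'M[R]_(d, e)) : psd (C *m C^T).
Proof. by have := psd_congr C (psd1 e); rewrite mulmx1. Qed.

Lemma psd_diag_ge0 d (A : 'M[R]_d) i : psd A -> 0 <= A i i.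
Proof.
by move=> [_ /(_ (delta_mx i 0))]; rewrite trmx_delta -rowE -colE !mxE.
Qed.

Lemma psd_tr_ge0 d (A : 'M[R]_d) : psd A -> 0 <= \tr A.
Proof. by move=> A0; apply: sumr_ge0 => i _; exact: psd_diag_ge0. Qed.

Lemma psd_diag_mx d (l : 'rV[R]_d) : (forall i, 0 <= l 0 i) -> psd (diag_mx l).
Proof.
move=> l0; split=> [|v]; first exact: tr_diag_mx.
rewrite -mulmxA mxE sumr_ge0// => i _.
by rewrite mul_diag_mx !mxE mulrCA -expr2 mulr_ge0// sqr_ge0.
Qed.

Lemma psd_spectral d (A : 'M[R]_d) : psd A -> exists (U : 'M[R]_d) (l : 'rV[R]_d),
  [/\ U *m U^T = 1%:M, A = U^T *m diag_mx l *m U & forall i, 0 <= l 0 i].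
Proof.
move=> A0; have [U [l [UU AE]]] := spectral_symmetric A0.1.
exists U, l; split=> // i; have := psd_diag_ge0 i (psd_congr U A0).
by rewrite AE !mulmxA UU mul1mx -mulmxA UU mulmx1 mxE eqxx.
Qed.

Lemma psd_sqrtP d (A : 'M[R]_d) :
  psd A -> psd (psd_sqrt A) /\ psd_sqrt A *m psd_sqrt A = A.
Proof.
move=> A0; apply: (@xgetPex _ 0 [set B | psd B /\ B *m B = A]).
have [U [l [UU AE l0]]] := psd_spectral A0.
pose r : 'rV_d := \row_i Num.sqrt (l 0 i).
exists (U^T *m diag_mx r *m U); split.
  rewrite -[U in _ *m U]trmxK; apply/psd_congr/psd_diag_mx => i.
  by rewrite mxE sqrtr_ge0.
rewrite AE -!mulmxA; congr (_ *m _); rewrite !mulmxA; congr (_ *m _).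
rewrite -(mulmxA (diag_mx r)) UU mulmx1 mulmx_diag; congr diag_mx.
by apply/rowP => i; rewrite !mxE -expr2 sqr_sqrtr.
Qed.

Lemma orthogonal_congr_tr d (U A : 'M[R]_d) :
  U *m U^T = 1%:M -> \tr (U *m A *m U^T) = \tr A.
Proof. by move=> /orthogonal_trK UU; rewrite mxtrace_mulC mulmxA UU mul1mx. Qed.

(* In an eigenbasis of [P], [P i i ^+ 2] is the diagonal entry of [P *m P],
   which dominates that of [N *m N], hence [N i i ^+ 2]. *)
Lemma tr_le_of_sqr d (P N : 'M[R]_d) :
  psd P -> psd N -> psd (P *m P - N *m N) -> \tr N <= \tr P.
Proof.
move=> P0 N0 PN0; have [U [l [UU PE l0]]] := psd_spectral P0.
have UtU := orthogonal_trK UU.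
rewrite -(orthogonal_congr_tr N UU) -(orthogonal_congr_tr P UU).
pose M := U *m N *m U^T.
have M0 : psd M by exact: psd_congr.
have DP : U *m P *m U^T = diag_mx l.
  by rewrite PE !mulmxA UU mul1mx -mulmxA UU mulmx1.
have : psd (diag_mx l *m diag_mx l - M *m M).
  rewrite -DP (_ : _ - _ = U *m (P *m P - N *m N) *m U^T); first exact: psd_congr.
  rewrite mulmxBr mulmxBl !mulmxA -[U *m P *m U^T *m U]mulmxA UtU mulmx1.
  by rewrite -[M *m U]mulmxA UtU mulmx1.
rewrite DP -/M => DM0; clearbody M; apply: ler_sum => i _.
have := psd_diag_ge0 i DM0.
rewrite mulmx_diag !mxE eqxx !mulr1n subr_ge0 -expr2 => le_sum.
rewrite -ler_sqr  ?nnegrE ?l0 ?(psd_diag_ge0 i M0)// (le_trans _ le_sum)//.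
rewrite (bigD1 i)//= -expr2 lerDl sumr_ge0// => k _.
by rewrite -[in X in X * _]M0.1 mxE -expr2 sqr_ge0.
Qed.

Lemma posdef_psd d (A : 'M[R]_d) : posdef A -> psd A.
Proof.
move=> [AT A0]; split=> // v; have [->|/A0/ltW//] := eqVneq v 0.
by rewrite mulmx0 mxE.
Qed.

Lemma posdef_unitmx d (A : 'M[R]_d) : posdef A -> A \in unitmx.
Proof.
move=> [AT A0]; rewrite -row_free_unit -kermx_eq0; apply/rowV0P => u.
move=> /sub_kermxP uA; apply/eqP/negPn/negP => u0.
have := A0 u^T; rewrite trmxK trmx_eq0 uA mul0mx mxE ltxx => /(_ u0).
by [].
Qed.

Lemma loewner_ge_posdef d (A : 'M[R]_d) s :
  0 < s -> loewner_ge A s%:M -> posdef A.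
Proof.
move=> s0 [AT A0]; split.
  by move: AT; rewrite trmxB tr_scalar_mx => /subIr.
move=> v v0; have := A0 v; rewrite mulmxBr mulmxBl mul_mx_scalar -scalemxAl.
rewrite mxE [X in _ + X]mxE [X in _ - X]mxE -sqnorm2E subr_ge0; apply: lt_le_trans.
by rewrite mulr_gt0// sqnorm2_gt0.
Qed.

(** The trace serves as a crude bound for the largest eigenvalue, each eigenvalue being one of the
    nonnegative summands. *)
Lemma psd_tr_scalar d (A : 'M[R]_d) : psd A -> psd ((\tr A)%:M - A).
Proof.
move=> A0; have [U [l [UU AE l0]]] := psd_spectral A0.
have -> : (\tr A)%:M - A = U^T *m diag_mx (\row_i (\tr A - l 0 i)) *m U^T^T.
  have -> : diag_mx (\row_i (\tr A - l 0 i)) = (\tr A)%:M - diag_mx l.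
    by apply/matrixP => i j; rewrite !mxE mulrnBl.
  rewrite mulmxBr mulmxBl trmxK mul_mx_scalar -scalemxAl (orthogonal_trK UU).
  by rewrite scalemx1 -AE.
apply/psd_congr/psd_diag_mx => i.
rewrite mxE subr_ge0 AE mxtrace_mulC mulmxA UU mul1mx mxtrace_diag.
by rewrite (bigD1 i)//= lerDl sumr_ge0.
Qed.

Lemma psd_sqr_le d (A : 'M[R]_d) : psd A -> psd (\tr A *: A - A *m A).
Proof.
move=> A0; have [[rT r0] rr] := psd_sqrtP A0.
have := psd_congr (psd_sqrt A) (psd_tr_scalar A0).
rewrite rT mulmxBr mulmxBl mul_mx_scalar -scalemxAl rr.
suff -> : psd_sqrt A *m A *m psd_sqrt A = A *m A by [].
transitivity (psd_sqrt A *m (psd_sqrt A *m psd_sqrt A) *m psd_sqrt A).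
  by rewrite rr.
by rewrite mulmxA -mulmxA !rr.
Qed.

Lemma loewner_ge_invmx d (A : 'M[R]_d) s :
  0 < s -> loewner_ge A s%:M -> loewner_ge (s^-1)%:M (invmx A).
Proof.
move=> s0 As; have Apd := loewner_ge_posdef s0 As.
have Au := posdef_unitmx Apd; have AT := Apd.1.
rewrite /loewner_ge.
(* The middle factor is [A (A - s)], rewritten as [(A - s)^2 + s (A - s)] to exhibit it as positive
   semidefinite. *)
have -> : s^-1%:M - invmx A =
    s^-1 *: (invmx A *m ((A - s%:M) *m (A - s%:M)^T + s *: (A - s%:M)) *m (invmx A)^T).
  have -> : (A - s%:M) *m (A - s%:M)^T + s *: (A - s%:M) = A *m (A - s%:M).
    by rewrite trmxB AT tr_scalar_mx -mul_scalar_mx -mulmxDl subrK.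
  rewrite trmx_inv AT mulKmx// mulmxBl mulmxV// mul_scalar_mx scalerBr scalerA.
  by rewrite mulVf ?gt_eqF// scale1r scalemx1.
apply: psdZ; first by rewrite invr_ge0 ltW.
apply/psd_congr/psdD; first exact: psd_gram.
by apply: psdZ; rewrite ?ltW.
Qed.

Lemma loewner_tr_congr d e (C : 'M[R]_(e, d)) (A : 'M[R]_d) s :
  loewner_ge A s%:M -> s * \tr (C *m C^T) <= \tr (C *m A *m C^T).
Proof.
move=> As; have := psd_tr_ge0 (psd_congr C As).
rewrite mulmxBr mulmxBl linearB /= mul_mx_scalar -scalemxAl subr_ge0.
by rewrite mxtraceZ.
Qed.

(** The diagonal entries of a diagonalization are exactly the eigenvalues, so the infimum is
    attained at the least of them. *)
Lemma lambda_minP d (A : 'M[R]_d) : (0 < d)%N -> posdef A ->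
  0 < lambda_min A /\ loewner_ge A (lambda_min A)%:M.
Proof.
case: d A => // d A _ Apd; have [AT A0] := Apd.
have [U [l [UU AE]]] := spectral_symmetric AT.
have UtU := orthogonal_trK UU.
have eigl i : eigenvalue A (l 0 i).
  apply/eigenvalueP; exists (row i U).
    rewrite AE -row_mul !mulmxA UU mul1mx row_mul; apply/rowP => j.
    by rewrite row_diag_mx -scalemxAl -rowE.
  apply/negP => /eqP Ui; have /matrixP/(_ i i) := UU.
  by rewrite !mxE eqxx big1 => [/eqP|k _]; [rewrite eq_sym oner_eq0|
    have /rowP/(_ k) := Ui; rewrite !mxE => ->; rewrite mul0r].
have eig_in a : eigenvalue A a -> exists i, a = l 0 i.
  move=> /eigenvalueP[v vA v0].
  have w0 : v *m U^T != 0.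
    apply: contra v0 => /eqP vU; rewrite -(mulmx1 v) -UtU mulmxA vU mul0mx//.
  have [i wi] : exists i, (v *m U^T) 0 i != 0.
    apply/existsP; apply: contraNT w0 => /existsPn H.
    by apply/eqP/rowP => i; rewrite [RHS]mxE; apply/eqP; rewrite -[_ == _]negbK.
  exists i; apply: (mulIf wi).
  have : (v *m A *m U^T) 0 i = (a *: (v *m U^T)) 0 i by rewrite vA scalemxAl.
  rewrite [RHS]mxE => <-.
  by rewrite AE !mulmxA -mulmxA UU mulmx1 mul_mx_diag mxE mulrC.
have [i0 _ lmin] := arg_minP (fun i => l 0 i) (P := predT) (i0 := ord0) isT.
have lb : lbound [set a | eigenvalue A a] (l 0 i0).
  by move=> a /eig_in[i ->]; exact: lmin.
have lminE : lambda_min A = l 0 i0.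
  apply/eqP; rewrite eq_le; apply/andP; split.
    by apply: inf_lbound; [exists (l 0 i0)|exact: eigl].
  by apply: lb_le_inf => //; exists (l 0 i0); exact: eigl.
rewrite lminE; split.
  have [v vA v0] := eigenvalueP (eigl i0).
  have := A0 v^T; rewrite trmxK trmx_eq0 vA -scalemxAl mxE => /(_ v0).
  by rewrite -{1}[v]trmxK -sqnorm2E pmulr_lgt0// sqnorm2_gt0 trmx_eq0.
rewrite /loewner_ge.
have -> : A - (l 0 i0)%:M = U^T *m diag_mx (\row_i (l 0 i - l 0 i0)) *m U^T^T.
  have -> : diag_mx (\row_i (l 0 i - l 0 i0)) = diag_mx l - (l 0 i0)%:M.
    by apply/matrixP => i j; rewrite !mxE mulrnBl.
  by rewrite mulmxBr mulmxBl trmxK mul_mx_scalar -scalemxAl UtU scalemx1 -AE.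
by apply/psd_congr/psd_diag_mx => i; rewrite mxE subr_ge0; exact: lmin.
Qed.

End psd_theory.

(** * The finite-dimensional program *)

Section program_theory.
Variable R : realType.

(** * Blocks, regression matrices and the objective of (D) *)

Section blocks.
Variables n m : nat.
Implicit Types (S : 'M[R]_(n + m)) (A : 'M[R]_(n, m)).

(* The error matrix: [errmx A *m col_mx x y = x - A *m y]. *)
Definition errmx A : 'M[R]_(n, n + m) := row_mx 1%:M (- A).

(** The regression matrix of [x] on [y] under covariance [S]. *)
Definition gain S : 'M[R]_(n, m) := ursubmx S *m invmx (drsubmx S).

Lemma psd_drsubmx S : psd S -> psd (drsubmx S).
Proof.
move=> S0; have := psd_congr (row_mx (0 : 'M[R]_(m, n)) 1%:M) S0.
rewrite -{1}(submxK S) mul_row_block tr_row_mx mul_row_col trmx0 trmx1.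
by rewrite mulmx0 !mul0mx !mul1mx mulmx1 !add0r.
Qed.

Lemma psd_ulsubmx S : psd S -> psd (ulsubmx S).
Proof.
move=> S0; have := psd_congr (row_mx 1%:M (0 : 'M[R]_(n, m))) S0.
rewrite -{1}(submxK S) mul_row_block tr_row_mx mul_row_col trmx0 trmx1.
by rewrite mulmx0 !mul0mx !mul1mx mulmx1 !addr0.
Qed.

Lemma loewner_ge_drsubmx S s : loewner_ge S s%:M -> loewner_ge (drsubmx S) s%:M.
Proof.
move=> /psd_drsubmx; suff -> : drsubmx (S - s%:M) = drsubmx S - s%:M by [].
by apply/matrixP => i j; rewrite !mxE eq_rshift.
Qed.

Lemma errmxE A S : S^T = S ->
  errmx A *m S *m (errmx A)^T = ulsubmx S - A *m dlsubmx S -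
    (ursubmx S - A *m drsubmx S) *m A^T.
Proof.
move=> ST; rewrite -{1}(submxK S) mul_row_block tr_row_mx mul_row_col.
by rewrite !mul1mx trmx1 mulmx1 !mulNmx linearN mulmxN.
Qed.

(** Completing the square in [A] around the regression matrix; the remainder is the Schur
    complement, whose trace is the objective of (D). *)
Lemma errmx_square A S : S^T = S -> drsubmx S \in unitmx ->
  errmx A *m S *m (errmx A)^T =
    (ulsubmx S - ursubmx S *m invmx (drsubmx S) *m dlsubmx S) +
    (A - gain S) *m drsubmx S *m (A - gain S)^T.
Proof.
move=> ST Su; rewrite errmxE// -/(gain S).
have yyT : (drsubmx S)^T = drsubmx S by rewrite trmx_drsub ST.
have GS : gain S *m drsubmx S = ursubmx S by rewrite mulmxKV.
have SG : drsubmx S *m (gain S)^T = dlsubmx S.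
  by rewrite -[X in X *m _]yyT -trmx_mul GS trmx_ursub ST.
have -> : (A - gain S) *m drsubmx S = - (ursubmx S - A *m drsubmx S).
  by rewrite mulmxBl GS opprB.
have EG : (ursubmx S - A *m drsubmx S) *m (gain S)^T
    = gain S *m dlsubmx S - A *m dlsubmx S.
  by rewrite mulmxBl -mulmxA SG -{1}GS -mulmxA SG.
by rewrite trmxB mulNmx mulmxBr EG opprB !addrA subrK.
Qed.

Lemma D_objectiveE S : S^T = S -> drsubmx S \in unitmx ->
  D_objective S = \tr (errmx (gain S) *m S *m (errmx (gain S))^T).
Proof. by move=> ST Su; rewrite errmx_square// subrr !mul0mx addr0. Qed.

Lemma D_objective_square A S : S^T = S -> drsubmx S \in unitmx ->
  \tr (errmx A *m S *m (errmx A)^T) =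
  D_objective S + \tr ((A - gain S) *m drsubmx S *m (A - gain S)^T).
Proof. by move=> ST Su; rewrite errmx_square// linearD. Qed.

Lemma D_objective_le A S : psd S -> drsubmx S \in unitmx ->
  D_objective S <= \tr (errmx A *m S *m (errmx A)^T).
Proof.
move=> S0 Su; rewrite D_objective_square//; last exact: S0.1.
by rewrite lerDl; apply/psd_tr_ge0/psd_congr/psd_drsubmx.
Qed.

Lemma drsubmx_unit S (s : R) : 0 < s -> loewner_ge S s%:M -> drsubmx S \in unitmx.
Proof.
by move=> s0 /loewner_ge_drsubmx/(loewner_ge_posdef s0)/posdef_unitmx.
Qed.

(** The objective is a minimum over [A] of functionals linear in [S]: the minimizer at the mixture
    is a competitor at both end points. *)
Lemma D_objective_concave (s : R) S1 S2 (t : R) : 0 < s ->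
  loewner_ge S1 s%:M -> loewner_ge S2 s%:M -> 0 <= t -> t <= 1 ->
  t * D_objective S1 + (1 - t) * D_objective S2 <=
  D_objective (t *: S1 + (1 - t) *: S2).
Proof.
move=> s0 S1s S2s t0 t1; set S := t *: S1 + _.
have t1' : 0 <= 1 - t by rewrite subr_ge0.
have P1 := posdef_psd (loewner_ge_posdef s0 S1s).
have P2 := posdef_psd (loewner_ge_posdef s0 S2s).
have Ss : loewner_ge S s%:M.
  rewrite /loewner_ge.
  have -> : S - s%:M = t *: (S1 - s%:M) + (1 - t) *: (S2 - s%:M).
    rewrite /S !scalerBr addrACA -opprD -scalerDl.
    by rewrite [t + _]addrC subrK scale1r.
  by apply: psdD; exact: psdZ.
have PS := posdef_psd (loewner_ge_posdef s0 Ss).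
rewrite (D_objectiveE PS.1 (drsubmx_unit s0 Ss)).
rewrite {2}/S mulmxDr mulmxDl linearD /= -!scalemxAr -!scalemxAl !mxtraceZ.
by apply: lerD; apply: ler_wpM2l => //; apply: D_objective_le => //;
  [exact: (drsubmx_unit s0 S1s)|exact: (drsubmx_unit s0 S2s)].
Qed.

End blocks.

(** The squared Bures distance, that is, the left side of the trace constraint of (D). *)
Definition bures d (Sigma S : 'M[R]_d) : R :=
  \tr (S + Sigma - 2 *: psd_sqrt (psd_sqrt Sigma *m S *m psd_sqrt Sigma)).

(** * Convexity, couplings and bounds for the Bures distance *)

Section bures.
Variables (d : nat) (Sigma : 'M[R]_d).
Hypothesis Sigma_posdef : posdef Sigma.
Implicit Types S : 'M[R]_d.

Let r := psd_sqrt Sigma.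

Let rP : psd r /\ r *m r = Sigma.
Proof. exact/psd_sqrtP/posdef_psd. Qed.

Let mid_psd S : psd S -> psd (r *m S *m r).
Proof. by move=> S0; rewrite -[X in _ *m X]rP.1.1; exact: psd_congr. Qed.

Lemma buresE S : bures Sigma S = \tr S + \tr Sigma - 2 * \tr (psd_sqrt (r *m S *m r)).
Proof. by rewrite /bures linearB /= linearD /= mxtraceZ. Qed.

(** Only the trace of the root is not affine in [S]. Its concavity comes from [tr_le_of_sqr], since
    [t Q1^2 + (1-t) Q2^2 - (t Q1 + (1-t) Q2)^2 = t (1-t) (Q1 - Q2)^2]. *)
Lemma bures_convex S1 S2 (t : R) : psd S1 -> psd S2 -> 0 <= t -> t <= 1 ->
  bures Sigma (t *: S1 + (1 - t) *: S2) <=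
  t * bures Sigma S1 + (1 - t) * bures Sigma S2.
Proof.
move=> P1 P2 t0 t1; have t1' : 0 <= 1 - t by rewrite subr_ge0.
have [q1 q1E] := psd_sqrtP (mid_psd P1).
have [q2 q2E] := psd_sqrtP (mid_psd P2).
have [q qE] := psd_sqrtP (mid_psd (psdD (psdZ t0 P1) (psdZ t1' P2))).
rewrite !buresE.
set Q1 := psd_sqrt _ in q1 q1E *; set Q2 := psd_sqrt _ in q2 q2E *.
set Q := psd_sqrt _ in q qE *.
have : \tr (t *: Q1 + (1 - t) *: Q2) <= \tr Q.
  apply: tr_le_of_sqr => //; first by apply: psdD; exact: psdZ.
  rewrite qE mulmxDr mulmxDl -!scalemxAr -!scalemxAl -q1E -q2E.
  suff -> : t *: (Q1 *m Q1) + (1 - t) *: (Q2 *m Q2) -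
     (t *: Q1 + (1 - t) *: Q2) *m (t *: Q1 + (1 - t) *: Q2) =
     (t * (1 - t)) *: ((Q1 - Q2) *m (Q1 - Q2)^T).
    by apply: psdZ; [exact: mulr_ge0|exact: psd_gram].
  rewrite trmxB q1.1 q2.1 !mulmxBr !mulmxBl !mulmxDr !mulmxDl.
  rewrite -!scalemxAl -!scalemxAr !scalerA.
  move: (Q1 *m Q1) (Q1 *m Q2) (Q2 *m Q1) (Q2 *m Q2) => A B C D.
  by apply/matrixP => i j; rewrite !mxE; ring.
rewrite !linearD /= !mxtraceZ => le_tr.
rewrite -subr_ge0 (_ : _ - _ = 2 * (\tr Q - (t * \tr Q1 + (1 - t) * \tr Q2))).
  by rewrite mulr_ge0// subr_ge0.
ring.
Qed.

(* For [Z] standard normal, [(X Z, Sigma^(1/2) Z)] is an optimal coupling of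
   [N(0, S)] and [N(0, Sigma)]. *)
Lemma bures_factor S : psd S -> exists X : 'M[R]_d,
  X *m X^T = S /\ \tr ((X - r) *m (X - r)^T) = bures Sigma S.
Proof.
move=> S0; have [q qE] := psd_sqrtP (mid_psd S0).
rewrite buresE; set Q := psd_sqrt (r *m S *m r) in q qE *.
have [[rT _] rr] := rP.
have ru : r \in unitmx.
  by have := posdef_unitmx Sigma_posdef; rewrite -rr unitmx_mul => /andP[].
have XT : (invmx r *m Q)^T = Q *m invmx r by rewrite trmx_mul trmx_inv rT q.1.
have XX : invmx r *m Q *m (invmx r *m Q)^T = S.
  by rewrite XT mulmxA -(mulmxA _ Q Q) qE !mulmxA mulVmx// mul1mx mulmxK.
(* With [Q^2 = r S r] this factor has Gram matrix [S], and its product with [r] has trace [tr Q],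
   the cross term of the Bures distance. *)
exists (invmx r *m Q); split=> //.
rewrite trmxB mulmxBr 2!mulmxBl XX XT rT rr !linearB /=.
have -> : \tr (invmx r *m Q *m r) = \tr Q.
  by rewrite mxtrace_mulC mulmxA mulmxV// mul1mx.
have -> : \tr (r *m (Q *m invmx r)) = \tr Q.
  by rewrite mxtrace_mulC -mulmxA mulVmx// mulmx1.
by ring.
Qed.

(** [L] transports [N(0, Sigma)] to [N(0, L Sigma L)] at the cost on the right. Formally, [r L r] is
    positive semidefinite with square [r (L Sigma L) r], so its trace is compared with that of
    [psd_sqrt]. *)
Lemma bures_congr_le (L : 'M[R]_d) : psd L ->
  bures Sigma (L *m Sigma *m L) <= \tr ((L - 1%:M) *m Sigma *m (L - 1%:M)).
Proof.
move=> L0; have [[rT _] rr] := rP; have SP := posdef_psd Sigma_posdef.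
have P0 : psd (L *m Sigma *m L) by rewrite -[X in _ *m X]L0.1; exact: psd_congr.
have [q qE] := psd_sqrtP (mid_psd P0).
have : \tr (r *m L *m r) <= \tr (psd_sqrt (r *m (L *m Sigma *m L) *m r)).
  apply: tr_le_of_sqr => //; first exact: mid_psd.
  by rewrite qE -rr !mulmxA subrr; exact: psd0.
rewrite buresE (_ : \tr (r *m L *m r) = \tr (Sigma *m L)) => [le_tr|]; last first.
  by rewrite mxtrace_mulC mulmxA rr.
rewrite !mulmxBr !mulmxBl mulmx1 mul1mx !linearB /= mulmx1.
rewrite (mxtrace_mulC L Sigma); lra.
Qed.

(** In Frobenius norm, [|X|^2 <= 2 |X - r|^2 + 2 |r|^2] for the factor [X] of [bures_factor]; the
    gap is [|X - 2 r|^2]. *)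
Lemma bures_tr_bound S : psd S ->
  \tr S <= 2 * bures Sigma S + 2 * \tr Sigma.
Proof.
move=> S0; have [X [XX <-]] := bures_factor S0; have [[rT _] rr] := rP.
have := psd_tr_ge0 (psd_gram (X - 2 *: r)).
rewrite !trmxB trmxZ rT !mulmxBr !mulmxBl -!scalemxAr -!scalemxAl XX rr.
rewrite !linearB /= !mxtraceZ; lra.
Qed.

End bures.
Lemma posdef_orthogonal_diag_gt0 d (A U : 'M[R]_d) i :
  posdef A -> U *m U^T = 1%:M -> 0 < (U *m A *m U^T) i i.
Proof.
move=> Apd UU; pose v : 'cV[R]_d := U^T *m delta_mx i 0.
have v0 : v != 0.
  apply/negP => /eqP/(congr1 (mulmx U)); rewrite mulmxA UU mul1mx mulmx0.
  by move=> /colP/(_ i); rewrite !mxE !eqxx => /eqP; rewrite oner_eq0.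
suff -> : (U *m A *m U^T) i i = (v^T *m A *m v) 0 0 by exact: Apd.2.
transitivity ((delta_mx 0 i *m (U *m A *m U^T) *m delta_mx i 0 : 'M[R]_1) 0 0).
  by move: (U *m A *m U^T) => M; rewrite -rowE -colE !mxE.
by rewrite /v trmx_mul trmxK trmx_delta !mulmxA.
Qed.

Lemma mxtrace_diag_mul d (l k : 'rV[R]_d) (M : 'M[R]_d) :
  \tr (diag_mx l *m M *m diag_mx k) = \sum_i l 0 i * k 0 i * M i i.
Proof.
by apply: eq_bigr => i _; rewrite mul_mx_diag mul_diag_mx !mxE mulrAC.
Qed.

(** * The feasible set of (D) and first-order optimality *)

Section feasible.
Variables (n m : nat) (Sigma : 'M[R]_(n + m)) (rho : R).
Hypothesis n_ge1 : (1 <= n)%N.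
Hypothesis Sigma_posdef : posdef Sigma.
Implicit Types S : 'M[R]_(n + m).

Let sigma := lambda_min Sigma.

Let sigmaP : 0 < sigma /\ loewner_ge Sigma sigma%:M.
Proof. by apply: lambda_minP => //; rewrite addn_gt0 n_ge1. Qed.

Lemma D_feasibleP S : D_feasible Sigma rho S <->
  loewner_ge S sigma%:M /\ bures Sigma S <= rho ^+ 2.
Proof.
split=> [[_ _ _ _ []]|[Ss bS]]//.
have S0 := posdef_psd (loewner_ge_posdef sigmaP.1 Ss).
split=> //; [exact: psd_ulsubmx|exact: psd_drsubmx|].
by rewrite trmx_dlsub S0.1.
Qed.

Lemma D_feasible_posdef S : D_feasible Sigma rho S -> posdef S.
Proof. by move=> /D_feasibleP[/(loewner_ge_posdef sigmaP.1)]. Qed.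

Lemma D_feasible_unit S : D_feasible Sigma rho S -> drsubmx S \in unitmx.
Proof. by move=> /D_feasibleP[/(drsubmx_unit sigmaP.1)]. Qed.

Lemma D_feasible_conv S1 S2 (t : R) :
  D_feasible Sigma rho S1 -> D_feasible Sigma rho S2 -> 0 <= t -> t <= 1 ->
  D_feasible Sigma rho (t *: S1 + (1 - t) *: S2).
Proof.
move=> F1 F2 t0 t1; have t1' : 0 <= 1 - t by rewrite subr_ge0.
have P1 := posdef_psd (D_feasible_posdef F1).
have P2 := posdef_psd (D_feasible_posdef F2).
move: F1 F2 => /D_feasibleP[S1s b1] /D_feasibleP[S2s b2].
apply/D_feasibleP; split.
  rewrite /loewner_ge.
  have -> : t *: S1 + (1 - t) *: S2 - sigma%:M =
      t *: (S1 - sigma%:M) + (1 - t) *: (S2 - sigma%:M).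
    by apply/matrixP => i j; rewrite !mxE; ring.
  by apply: psdD; exact: psdZ.
apply: (le_trans (bures_convex Sigma_posdef P1 P2 t0 t1)).
have -> : rho ^+ 2 = t * rho ^+ 2 + (1 - t) * rho ^+ 2 by ring.
by apply: lerD; exact: ler_wpM2l.
Qed.

Lemma convex_D_feasible : convex_set (D_feasible Sigma rho).
Proof.
move=> S1 S2 t; rewrite !inE => F1 F2.
by apply: D_feasible_conv.
Qed.

Lemma concave_D_objective :
  concave_function (D_feasible Sigma rho) (@D_objective R n m).
Proof.
move=> t S1 S2; rewrite !inE => /D_feasibleP[S1s _] /D_feasibleP[S2s _].
rewrite lerNl.
apply: le_trans (D_objective_concave sigmaP.1 S1s S2s _ _) => //.
rewrite convRE opprD !mulrN !opprK//.
Qed.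

(** A dilation keeps the spectrum above [sigma]: [L Sigma L - sigma = L (Sigma - sigma) L + sigma
    (L^2 - 1)], and [L^2 - 1 = (L - 1)^2 + 2 (L - 1)]. *)
Lemma D_feasible_dilation (L : 'M[R]_(n + m)) :
  loewner_ge L 1%:M -> \tr ((L - 1%:M) *m Sigma *m (L - 1%:M)) <= rho ^+ 2 ->
  D_feasible Sigma rho (L *m Sigma *m L).
Proof.
move=> L1 trL; have L0 := posdef_psd (loewner_ge_posdef ltr01 L1).
apply/D_feasibleP; split; last exact: le_trans (bures_congr_le Sigma_posdef L0) trL.
rewrite /loewner_ge.
have -> : L *m Sigma *m L - sigma%:M = L *m (Sigma - sigma%:M) *m L^T +
   sigma *: ((L - 1%:M) *m (L - 1%:M)^T + 2 *: (L - 1%:M)).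
  rewrite trmxB L0.1 trmx1 !mulmxBr !mulmxBl !mulmx1 !mul1mx mul_mx_scalar.
  rewrite -scalemxAl -[sigma%:M]scalemx1.
  move: (L *m Sigma *m L) (L *m L) => A B.
  by apply/matrixP => i j; rewrite !mxE; ring.
apply: psdD; first exact: psd_congr sigmaP.2.
apply: psdZ; first exact: ltW sigmaP.1.
by apply: psdD; [exact: psd_gram|exact: psdZ].
Qed.

(** Stretching the [i]-th row direction of [U] by [1 + t_i / s_i] raises the standard deviation in
    that direction from [s_i] to [s_i + t_i], at total transport cost [\sum t_i^2]. *)
Lemma D_feasible_spectral (U : 'M[R]_(n + m)) (t : 'rV[R]_(n + m)) :
  U *m U^T = 1%:M -> (forall i, 0 <= t 0 i) -> \sum_i t 0 i ^+ 2 <= rho ^+ 2 ->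
  let s i := Num.sqrt ((U *m Sigma *m U^T) i i) in
  exists2 S, D_feasible Sigma rho S &
    forall l : 'rV[R]_(n + m), \tr (U^T *m diag_mx l *m U *m S) =
      \sum_i l 0 i * (s i + t 0 i) ^+ 2.
Proof.
move=> UU t0 t_le s; pose W := U *m Sigma *m U^T.
have UtU := orthogonal_trK UU.
have W_gt0 i : 0 < W i i by exact: posdef_orthogonal_diag_gt0.
have s_gt0 i : 0 < s i by rewrite sqrtr_gt0.
have s_sqr i : W i i = s i ^+ 2 by rewrite sqr_sqrtr// ltW.
pose k := \row_i (t 0 i / s i).
pose k1 := \row_i (1 + k 0 i).
pose L := U^T *m diag_mx k1 *m U.
have L1E : L - 1%:M = U^T *m diag_mx k *m U.
  have -> : diag_mx k = diag_mx k1 - 1%:M.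
    by apply/matrixP => i j; rewrite !mxE -mulrnBl addrC addKr.
  by rewrite mulmxBr mulmx1 mulmxBl UtU.
have trW (l l' : 'rV[R]_(n + m)) :
    \tr (U^T *m diag_mx l *m U *m Sigma *m (U^T *m diag_mx l' *m U)) =
    \sum_i l 0 i * l' 0 i * W i i.
  rewrite -mxtrace_diag_mul -!mulmxA mxtrace_mulC -!mulmxA UU mulmx1.
  by rewrite /W !mulmxA.
exists (L *m Sigma *m L).
  apply: D_feasible_dilation; rewrite ?/loewner_ge L1E.
    rewrite -[U in _ *m U]trmxK; apply/psd_congr/psd_diag_mx => i.
    by rewrite mxE divr_ge0// ltW.
  apply: le_trans t_le; rewrite trW le_eqVlt; apply/orP; left; apply/eqP.
  apply: eq_bigr => i _; rewrite s_sqr [k 0 i]mxE.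
  by field; rewrite gt_eqF.
move=> l; rewrite (mulmxA _ (L *m Sigma) L) (mulmxA _ L Sigma).
have -> : U^T *m diag_mx l *m U *m L = U^T *m diag_mx (\row_i (l 0 i * k1 0 i)) *m U.
  by rewrite -mulmx_diag /L !mulmxA -(mulmxA _ U) UU mulmx1.
rewrite trW; apply: eq_bigr => i _; rewrite s_sqr !mxE.
by field; rewrite gt_eqF.
Qed.

(** Dominates the trace, hence every eigenvalue, of a feasible matrix. *)
Let K := 2 * rho ^+ 2 + 2 * \tr Sigma.

Lemma D_feasible_tr S : D_feasible Sigma rho S -> \tr S <= K.
Proof.
move=> F; have P := posdef_psd (D_feasible_posdef F).
have /D_feasibleP[_ bS] := F.
have := bures_tr_bound Sigma_posdef P; rewrite /K; lra.
Qed.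

Lemma D_objective_tr S : D_feasible Sigma rho S -> D_objective S <= \tr S.
Proof.
move=> F; have P := posdef_psd (D_feasible_posdef F).
apply: le_trans (D_objective_le 0 P (D_feasible_unit F)) _.
rewrite (errmxE _ P.1) !mul0mx trmx0 mulmx0 !subr0.
rewrite -[S in X in _ <= X]submxK mxtrace_block lerDl.
exact/psd_tr_ge0/psd_drsubmx.
Qed.

Lemma errmx_mulr A S : errmx A *m S =
  row_mx (ulsubmx S - A *m dlsubmx S) (ursubmx S - A *m drsubmx S).
Proof. by rewrite -{1}(submxK S) mul_row_block !mul1mx !mulNmx. Qed.

(** The matrix [E] is the observation block of [B S], so [|E|^2 <= tr (B S^2 B^T) <= K tr (B S B^T)
    <= K^2 tr (B B^T)]. Finally [sigma tr (B B^T) <= tr (B S0 B^T)], which is the objective at [S0]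
    and so at most [K]. *)
Let cross_bound S0 S : D_feasible Sigma rho S0 -> D_feasible Sigma rho S ->
  \tr ((ursubmx S - gain S0 *m drsubmx S) *m (ursubmx S - gain S0 *m drsubmx S)^T)
    <= K ^+ 3 / sigma.
Proof.
move=> F0 F; set E := _ - _; set B := errmx (gain S0).
have P0 := posdef_psd (D_feasible_posdef F0).
have P := posdef_psd (D_feasible_posdef F).
have K0 : 0 <= K := le_trans (psd_tr_ge0 P) (D_feasible_tr F).
have BB : \tr (B *m B^T) <= K / sigma.
  rewrite ler_pdivlMr ?sigmaP.1// mulrC.
  have /D_feasibleP[S0s _] := F0.
  apply: le_trans (loewner_tr_congr B S0s) _.
  rewrite -D_objectiveE ?(D_feasible_unit F0)//; last exact: P0.1.
  exact: le_trans (D_objective_tr F0) (D_feasible_tr F0).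
have BB0 : 0 <= \tr (B *m B^T) by exact/psd_tr_ge0/psd_gram.
have BSB : \tr (B *m S *m B^T) <= K * \tr (B *m B^T).
  have := psd_tr_ge0 (psd_congr B (psd_tr_scalar P)).
  rewrite mulmxBr mulmxBl linearB /= mul_mx_scalar -scalemxAl mxtraceZ subr_ge0.
  by move=> /le_trans; apply; rewrite ler_wpM2r// D_feasible_tr.
have BSB0 : 0 <= \tr (B *m S *m B^T) by exact/psd_tr_ge0/psd_congr.
have BSSB : \tr (B *m S *m S *m B^T) <= K * \tr (B *m S *m B^T).
  have := psd_tr_ge0 (psd_congr B (psd_sqr_le P)).
  rewrite mulmxBr mulmxBl linearB /= -scalemxAr -scalemxAl mxtraceZ subr_ge0 mulmxA.
  by move=> /le_trans; apply; rewrite ler_wpM2r// D_feasible_tr.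
have EB : \tr (E *m E^T) <= \tr (B *m S *m S *m B^T).
  have -> : B *m S *m S *m B^T = (B *m S) *m (B *m S)^T.
    by rewrite trmx_mul P.1 !mulmxA.
  rewrite errmx_mulr tr_row_mx mul_row_col mxtraceD lerDr.
  exact/psd_tr_ge0/psd_gram.
apply: (le_trans EB); apply: (le_trans BSSB).
rewrite exprS -mulrA ler_wpM2l// expr2 -mulrA; apply: (le_trans BSB).
by rewrite ler_wpM2l.
Qed.

(* First-order optimality of a near-optimal [S0] in the direction [S]: the
   second-order term of the objective along the segment is at most
   [e ^+ 2 * (K ^+ 3 / sigma ^+ 2)]. *)
Lemma D_first_order S0 S (eta e : R) :
  D_feasible Sigma rho S0 -> D_feasible Sigma rho S ->
  (forall S', D_feasible Sigma rho S' -> D_objective S' <= D_objective S0 + eta) ->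
  0 < e -> e <= 1 ->
  \tr (errmx (gain S0) *m S *m (errmx (gain S0))^T) <=
    D_objective S0 + eta / e + e * (K ^+ 3 / sigma ^+ 2).
Proof.
move=> F0 F opt e0 e1; set B := errmx _; set c := \tr _.
pose Se := e *: S + (1 - e) *: S0.
have Fe : D_feasible Sigma rho Se by apply: D_feasible_conv => //; exact: ltW.
have Pe := posdef_psd (D_feasible_posdef Fe).
have P0 := posdef_psd (D_feasible_posdef F0).
have ue := D_feasible_unit Fe; have u0 := D_feasible_unit F0.
have /D_feasibleP[Ses _] := Fe.
pose E := ursubmx S - gain S0 *m drsubmx S.
have EE : \tr (E *m E^T) <= K ^+ 3 / sigma by exact: cross_bound.
have key : \tr (B *m Se *m B^T) = D_objective Se +
    e ^+ 2 * \tr (E *m invmx (drsubmx Se) *m E^T).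
  rewrite D_objective_square//; last exact: Pe.1.
  congr (_ + _).
  (* The residual of [gain S0] vanishes at [S0], so along the segment it is just [e E]. *)
  have -> : gain S0 - gain Se = - (e *: (E *m invmx (drsubmx Se))).
    apply: (can_inj (mulmxK ue)); rewrite /= mulNmx -scalemxAl mulmxKV// mulmxBl.
    rewrite mulmxKV// /E.
    have -> : ursubmx Se = e *: ursubmx S + (1 - e) *: ursubmx S0.
      by apply/matrixP => i j; rewrite !mxE.
    have -> : drsubmx Se = e *: drsubmx S + (1 - e) *: drsubmx S0.
      by apply/matrixP => i j; rewrite !mxE.
    have <- : gain S0 *m drsubmx S0 = ursubmx S0 by rewrite mulmxKV.
    rewrite mulmxDr -!scalemxAr opprD addrACA subrr addr0 scalerBr opprB//.
  have DT : (drsubmx Se)^T = drsubmx Se by rewrite trmx_drsub Pe.1.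
  rewrite linearN /= mulmxN !mulNmx opprK trmxZ -scalemxAr -!scalemxAl mulmxKV//.
  by rewrite scalerA mxtraceZ trmx_mul trmx_inv DT mulmxA -expr2.
have quad : \tr (E *m invmx (drsubmx Se) *m E^T) <= K ^+ 3 / sigma ^+ 2.
  have := psd_tr_ge0 (psd_congr E (loewner_ge_invmx sigmaP.1 (loewner_ge_drsubmx Ses))).
  rewrite mulmxBr mulmxBl linearB /= mul_mx_scalar -scalemxAl mxtraceZ subr_ge0.
  move=> /le_trans; apply.
  have -> : K ^+ 3 / sigma ^+ 2 = sigma^-1 * (K ^+ 3 / sigma).
    by field; rewrite gt_eqF ?sigmaP.1.
  by rewrite ler_wpM2l// invr_ge0 ltW ?sigmaP.1.
have split : \tr (B *m Se *m B^T) = e * c + (1 - e) * D_objective S0.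
  rewrite /Se mulmxDr mulmxDl linearD /= -!scalemxAr -!scalemxAl !mxtraceZ.
  by rewrite -D_objectiveE//; exact: P0.1.
(* Linearity ([split]), the square ([key]) and near-optimality at [Se] give
   [e c <= e D(S0) + eta + e^2 C]; dividing by [e] concludes. *)
have ob := opt _ Fe.
have e2 : 0 <= e ^+ 2 := sqr_ge0 e.
have := ler_wpM2l e2 quad; move: key; rewrite split.
set q := e ^+ 2 * _; set C := K ^+ 3 / _ => eq_q q_le.
have : e * c <= e * (D_objective S0 + eta / e + e * C).
  rewrite !mulrDr [e * (eta / e)]mulrC divfK ?gt_eqF// mulrA -expr2; lra.
by rewrite ler_pM2l.
Qed.

End feasible.
End program_theory.

(** * Rotation invariance of the planar Gaussian *)

Section plane_gauss.
Variable R : realType.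
Local Notation mu := (@lebesgue_measure R).
Local Notation N01 := (normal_prob (0 : R) 1).
Local Open Scope ereal_scope.

Lemma lebesgue_measure_shift (a : R) (A : set (measurableTypeR R)) : measurable A ->
  pushforward mu ((fun x => x + a)%R : measurableTypeR R -> measurableTypeR R) A = mu A.
Proof.
have ma : measurable_fun setT
    ((fun x => x + a)%R : measurableTypeR R -> measurableTypeR R).
  exact: measurable_funD.
move=> mA; apply/esym.
pose fa : {mfun measurableTypeR R >-> measurableTypeR R} := HB.pack
  ((fun x => x + a)%R : measurableTypeR R -> measurableTypeR R)
  (isMeasurableFun.Build _ _ _ _ _ ma).
have := @lebesgue_measure_unique R (pushforward mu fa).
apply => // _ [[b c]] _ <-.
rewrite /pushforward/= [X in _ = mu X](_ : _ = `]b - a, c - a]%classic%R); last first.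
  by apply/seteqP; split=> x /=; rewrite !in_itv/= ltrBlDr lerBrDr.
by rewrite !lebesgue_measure_itv/= !lte_fin ltrD2r -!EFinD opprD addrACA opprK addNr addr0.
Qed.

Lemma ge0_integral_shift (a : R) (f : R -> \bar R) :
  measurable_fun setT f -> (forall x, 0 <= f x) ->
  \int[mu]_x f (x + a)%R = \int[mu]_x f x.
Proof.
move=> mf f0.
have ma : measurable_fun setT
    ((fun x => x + a)%R : measurableTypeR R -> measurableTypeR R).
  exact: measurable_funD.
rewrite -[LHS]/(\int[mu]_(x in (fun x => x + a)%R @^-1` setT) (f \o (fun x => x + a)%R) x).
rewrite -(ge0_integral_pushforward ma)//.
by apply: eq_measure_integral => A mA _; exact: lebesgue_measure_shift.
Qed.

Lemma ge0_integral_opp (f : R -> \bar R) :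
  measurable_fun setT f -> (forall x, 0 <= f x) ->
  \int[mu]_x f (- x)%R = \int[mu]_x f x.
Proof.
move=> mf f0.
have mN : measurable_fun setT (-%R : measurableTypeR R -> measurableTypeR R).
  exact: oppr_measurable.
rewrite -[LHS]/(\int[mu]_(x in -%R @^-1` setT) (f \o -%R) x).
rewrite -(ge0_integral_pushforward mN)//.
by apply: eq_measure_integral => A mA _; exact: lebesgue_measureN.
Qed.

(** The Radon-Nikodym derivative agrees with [normal_pdf] almost everywhere because both have the
    same integral over every measurable set. *)
Lemma ge0_integral_normal_prob (f : R -> \bar R) :
  measurable_fun setT f -> (forall x, 0 <= f x) ->
  \int[N01]_x f x = \int[mu]_x (f x * (normal_pdf 0 1 x)%:E).
Proof.
move=> mf f0.
rewrite -(Radon_Nikodym_SigmaFinite.change_of_variables (normal_prob_dominates 0 1))//.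
have dom := normal_prob_dominates (0 : R) 1.
have intf := Radon_Nikodym_SigmaFinite.f_integrable dom.
apply: ae_eq_integral => //.
- by apply: emeasurable_funM => //; exact: measurable_int intf.
- by apply: emeasurable_funM => //; apply/measurable_EFinP; exact: measurable_normal_pdf.
- apply: ae_eqe_mul2l; apply: integral_ae_eq => //.
    by apply/measurable_EFinP; exact: measurable_normal_pdf.
  by move=> E _ mE; rewrite -Radon_Nikodym_SigmaFinite.f_integral.
Qed.

Let T2 := (measurableTypeR R * measurableTypeR R)%type.

Let measurable_shear1 (t : R) :
  measurable_fun setT (fun z : T2 => (z.1 + t * z.2, z.2)%R : T2).
Proof.
apply/measurable_fun_pairP; split; last exact: measurable_snd.
by apply: measurable_funD; [exact: measurable_fst|exact: measurable_funM].
Qed.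

Let measurable_shear2 (t : R) :
  measurable_fun setT (fun z : T2 => (z.1, z.2 + t * z.1)%R : T2).
Proof.
apply/measurable_fun_pairP; split; first exact: measurable_fst.
by apply: measurable_funD; [exact: measurable_snd|exact: measurable_funM].
Qed.

(** With the second coordinate frozen a shear is a translation, so Tonelli reduces the claim to
    translation invariance. *)
Lemma ge0_integral_shear1 (t : R) (f : T2 -> \bar R) :
  measurable_fun setT f -> (forall z, 0 <= f z) ->
  \int[mu \x mu]_z f (z.1 + t * z.2, z.2)%R = \int[mu \x mu]_z f z.
Proof.
move=> mf f0; rewrite fubini_tonelli2 => [||z]//; last first.
  exact: (measurableT_comp mf (measurable_shear1 t)).
rewrite fubini_tonelli2//; apply: eq_integral => y _.
rewrite /fubini_G/= (ge0_integral_shift (t * y) (f := fun x => f (x, y)))//.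
exact: measurableT_comp.
Qed.

Lemma ge0_integral_shear2 (t : R) (f : T2 -> \bar R) :
  measurable_fun setT f -> (forall z, 0 <= f z) ->
  \int[mu \x mu]_z f (z.1, z.2 + t * z.1)%R = \int[mu \x mu]_z f z.
Proof.
move=> mf f0; rewrite fubini_tonelli1 => [||z]//; last first.
  exact: (measurableT_comp mf (measurable_shear2 t)).
rewrite fubini_tonelli1//; apply: eq_integral => x _.
rewrite /fubini_F/= (ge0_integral_shift (t * x) (f := fun y => f (x, y)))//.
exact: measurableT_comp.
Qed.

Let rot (c s : R) (z : T2) : T2 := (c * z.1 - s * z.2, s * z.1 + c * z.2)%R.

Let measurable_rot c s : measurable_fun setT (rot c s).
Proof.
apply/measurable_fun_pairP; split => /=.
  by apply: measurable_funB; apply: measurable_funM.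
by apply: measurable_funD; apply: measurable_funM.
Qed.

(* A rotation by an angle other than pi is a product of three shears. *)
Let lebesgue_rot (c s : R) (f : T2 -> \bar R) :
  (c ^+ 2 + s ^+ 2 = 1)%R -> c != (-1)%R ->
  measurable_fun setT f -> (forall z, 0 <= f z) ->
  \int[mu \x mu]_z f (rot c s z) = \int[mu \x mu]_z f z.
Proof.
(* The parameter [t] is the tangent of half the angle, finite because [c] is not [-1]. *)
move=> cs c1 mf f0; pose t := (s / (1 + c))%R.
have c1' : (1 + c != 0)%R by rewrite addrC addr_eq0.
have ts : (t * s = 1 - c)%R.
  apply: (mulIf c1'); rewrite /t mulrAC divfK//; nra.
have tc : (t + t * c = s)%R by rewrite -{1}[t]mulr1 -mulrDr /t divfK.
pose g (z : T2) := f (z.1 + (- t) * z.2, z.2)%R.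
pose h (z : T2) := g (z.1, z.2 + s * z.1)%R.
have mg : measurable_fun setT g.
  exact: (measurableT_comp mf (measurable_shear1 (- t))).
have mh : measurable_fun setT h.
  exact: (measurableT_comp mg (measurable_shear2 s)).
transitivity (\int[mu \x mu]_z h (z.1 + (- t) * z.2, z.2)%R).
  apply: eq_integral => -[x y] _; rewrite /h /g /rot /=.
  have E1 (u v : R) : (u + - t * v + - t * (v + s * (u + - t * v)) = c * u - s * v)%R.
    transitivity ((1 - t * s) * u - (t + t * (1 - t * s)) * v)%R; first by ring.
    by rewrite ts subKr tc.
  have E2 (u v : R) : (v + s * (u + - t * v) = s * u + c * v)%R.
    transitivity (s * u + (1 - t * s) * v)%R; first by ring.
    by rewrite ts subKr.
  by congr (f (_, _)); rewrite -?E1 -?E2.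
rewrite ge0_integral_shear1//; last by move=> z; exact: f0.
rewrite ge0_integral_shear2//; last by move=> z; exact: f0.
by rewrite ge0_integral_shear1.
Qed.

Let gauss_density (f : T2 -> \bar R) :
  measurable_fun setT f -> (forall z, 0 <= f z) ->
  \int[N01 \x N01]_z f z =
  \int[mu \x mu]_z (f z * ((normal_peak 1)^+2 * expR (- (z.1 ^+ 2 + z.2 ^+ 2) / 2))%:E).
Proof.
move=> mf f0.
rewrite fubini_tonelli1// ge0_integral_normal_prob//; first last.
- by move=> x; exact: integral_ge0.
- exact: measurable_fun_fubini_tonelli_F.
rewrite fubini_tonelli1 => [||z]; first last.
- by rewrite mule_ge0// lee_fin mulr_ge0 ?sqr_ge0 ?expR_ge0.
- apply: emeasurable_funM => //; apply/measurable_EFinP; apply: measurable_funM => //.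
  apply: measurableT_comp => //; apply: measurable_funM => //.
  apply: measurable_funN; apply: measurable_funD; exact: measurable_funX.
apply: eq_integral => x _; rewrite /fubini_F.
have mfx : measurable_fun setT (fun y => f (x, y)) by exact: measurableT_comp.
rewrite ge0_integral_normal_prob//.
rewrite -ge0_integralZr//; first last.
- by rewrite lee_fin normal_pdf_ge0.
- by move=> y _; rewrite mule_ge0// lee_fin normal_pdf_ge0.
- by apply: emeasurable_funM => //; apply/measurable_EFinP; exact: measurable_normal_pdf.
apply: eq_integral => y _; rewrite -muleA -EFinM; congr (_ * _%:E).
rewrite /normal_pdf oner_eq0 /normal_fun !subr0 expr1n.
rewrite [LHS]mulrACA -expr2 -expRD; congr (_ * expR _)%R.
by rewrite -mulrDl -opprD addrC.
Qed.

Lemma gauss_rot (c s : R) (f : T2 -> \bar R) :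
  (c ^+ 2 + s ^+ 2 = 1)%R -> measurable_fun setT f -> (forall z, 0 <= f z) ->
  \int[N01 \x N01]_z f (c * z.1 - s * z.2, s * z.1 + c * z.2)%R =
  \int[N01 \x N01]_z f z.
Proof.
move=> cs mf f0.
(* The half turn, excluded in [lebesgue_rot], is the square of a quarter turn. *)
wlog c1 : c s f cs mf f0 / c != (-1)%R.
  move=> H; have [cE|/H] := eqVneq c (-1)%R; last exact.
  have s0 : s = 0%R by apply/eqP; rewrite -sqrf_eq0; apply/eqP; rewrite cE in cs; lra.
  have i01 : (0 != -1 :> R)%R by rewrite eq_sym oppr_eq0 oner_eq0.
  have cs01 : (0 ^+ 2 + 1 ^+ 2 = 1 :> R)%R by rewrite expr0n expr1n add0r.
  rewrite -(H 0%R 1%R f cs01 mf f0 i01).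
  rewrite -(H 0%R 1%R _ cs01 (measurableT_comp mf (measurable_rot 0 1)) (fun z => f0 _) i01).
  have E1 (u v : R) : (0 * (0 * u - 1 * v) - 1 * (1 * u + 0 * v) = - 1 * u - 0 * v)%R.
    by ring.
  have E2 (u v : R) : (1 * (0 * u - 1 * v) + 0 * (1 * u + 0 * v) = 0 * u + - 1 * v)%R.
    by ring.
  by apply: eq_integral => -[x y] _ /=; rewrite cE s0 /rot/= E1 E2.
rewrite !gauss_density//; last exact: (measurableT_comp mf (measurable_rot c s)).
pose g (z : T2) := f z * ((normal_peak 1)^+2 * expR (- (z.1 ^+ 2 + z.2 ^+ 2) / 2))%:E.
rewrite -[RHS](lebesgue_rot cs c1).
- have E (u v : R) : ((c * u - s * v) ^+ 2 + (s * u + c * v) ^+ 2 = u ^+ 2 + v ^+ 2)%R.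
    by transitivity ((c ^+ 2 + s ^+ 2) * (u ^+ 2 + v ^+ 2))%R; [ring|rewrite cs mul1r].
  by apply: eq_integral => -[x y] _; rewrite /g /rot /= E.
- apply: emeasurable_funM => //; apply/measurable_EFinP; apply: measurable_funM => //.
  apply: measurableT_comp => //; apply: measurable_funM => //.
  by apply: measurable_funN; apply: measurable_funD; exact: measurable_funX.
- by move=> z; rewrite mule_ge0// lee_fin mulr_ge0 ?sqr_ge0 ?expR_ge0.
Qed.

End plane_gauss.

(** * Rotation invariance of the standard normal law *)

Section std_normal_invariance.
Variable R : realType.
Local Notation N01 := (normal_prob (0 : R) 1).
Local Open Scope ereal_scope.

Lemma measurable_mulmx m d (A : 'M[R]_(m, d)) :
  measurable_fun setT (fun z : 'cV[R]_d => A *m z).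
Proof.
apply: measurable_fun_mx => i j; under eq_fun do rewrite mxE.
by apply: measurable_sum => k; apply: measurable_funM => //; exact: measurable_entry.
Qed.

Lemma ge0_integral_std_normalS d (f : 'cV[R]_d.+1 -> \bar R) :
  measurable_fun setT f -> (forall z, 0 <= f z) ->
  \int[std_normal R d.+1]_z f z =
  \int[N01]_x \int[std_normal R d]_z f (consv (x, z)).
Proof.
move=> mf f0.
have mc := @measurable_consv R d.
rewrite -(fubini_tonelli1 (fun p => f (consv p)))//; last first.
  exact: measurableT_comp mf mc.
rewrite -[RHS]/(\int[_]_(p in (@consv R d) @^-1` setT) (f \o @consv R d) p).
rewrite -(ge0_integral_pushforward mc)//.
Qed.

(** Invariance is phrased with nonnegative integrands so that it combines with Tonelli;
    orthogonality is carried along so that transposes act as inverses. *)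
Definition std_invariant d (O : 'M[R]_d) : Prop :=
  O *m O^T = 1%:M /\ forall f : 'cV[R]_d -> \bar R,
    measurable_fun setT f -> (forall z, 0 <= f z) ->
    \int[std_normal R d]_z f (O *m z) = \int[std_normal R d]_z f z.

Lemma std_invariantM d (O1 O2 : 'M[R]_d) :
  std_invariant O1 -> std_invariant O2 -> std_invariant (O1 *m O2).
Proof.
move=> [u1 i1] [u2 i2]; split=> [|f mf f0].
  by rewrite trmx_mul mulmxA -(mulmxA O1) u2 mulmx1.
rewrite -(i1 f)// -(i2 (fun z => f (O1 *m z)))//.
  by apply: eq_integral => z _; rewrite mulmxA.
exact: measurableT_comp mf (measurable_mulmx O1).
Qed.

Lemma std_invariantV d (O : 'M[R]_d) : std_invariant O -> std_invariant O^T.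
Proof.
move=> [u i]; split=> [|f mf f0]; first by rewrite trmxK orthogonal_trK.
rewrite -(i (fun z => f (O^T *m z)))//.
  by apply: eq_integral => z _; rewrite mulmxA orthogonal_trK// mul1mx.
exact: measurableT_comp mf (measurable_mulmx O^T).
Qed.

Lemma block1_orthogonal d (O : 'M[R]_d) : O *m O^T = 1%:M ->
  block_mx (1%:M : 'M[R]_1) 0 0 O *m (block_mx (1%:M : 'M[R]_1) 0 0 O)^T = 1%:M.
Proof.
move=> OO; rewrite tr_block_mx mulmx_block !trmx1 !trmx0 !mulmx0 !mul0mx mulmx1.
by rewrite OO !addr0 add0r -scalar_mx_block.
Qed.

Lemma block1_consv d (O : 'M[R]_d) x (z : 'cV[R]_d) :
  (block_mx (1%:M : 'M[R]_1) 0 0 O : 'M[R]_d.+1) *m consv (x, z) = consv (x, O *m z).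
Proof.
rewrite -[LHS]/(block_mx (1%:M : 'M[R]_1) 0 0 O *m col_mx _ _) mul_block_col.
by rewrite !mul0mx mul1mx addr0 add0r.
Qed.

Lemma std_invariant_block d (O : 'M[R]_d) : std_invariant O ->
  std_invariant (block_mx (1%:M : 'M[R]_1) 0 0 O : 'M[R]_d.+1).
Proof.
move=> [u i]; split=> [|f mf f0].
  exact: block1_orthogonal.
rewrite !ge0_integral_std_normalS//; last first.
  exact: measurableT_comp mf (measurable_mulmx _).
apply: eq_integral => x _.
rewrite -(i (fun z => f (consv (x, z))))//; last first.
  apply: (measurableT_comp mf); apply: (measurableT_comp (@measurable_consv R d)).
  exact: pair1_measurable.
apply: eq_integral => z _; congr f.
by rewrite block1_consv.
Qed.

(** Rotation in the plane of the first two coordinates; the nested blocks match the nesting of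
    [consv]. *)
Definition rot_mx d (c s : R) : 'M[R]_(1 + (1 + d)) :=
  block_mx c%:M (row_mx (- s)%:M 0) (col_mx s%:M 0) (block_mx c%:M 0 0 1%:M).

Lemma rot_mx_orthogonal d (c s : R) : (c ^+ 2 + s ^+ 2 = 1)%R ->
  rot_mx d c s *m (rot_mx d c s)^T = 1%:M.
Proof.
move=> cs; have cs' : (c * c + s * s = 1)%R by rewrite -!expr2.
have rotT : (rot_mx d c s)^T = rot_mx d c (- s).
  rewrite /rot_mx !tr_block_mx tr_row_mx tr_col_mx !tr_scalar_mx !trmx0.
  by rewrite opprK.
rewrite rotT /rot_mx mulmx_block opprK.
rewrite mul_row_col mul_mx_row mul_row_block mul_col_mx mul_block_col mul_col_row mulmx_block.
rewrite ?(mulmx0, mul0mx, addr0, add0r, mulmx1, mul1mx).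
rewrite add_row_mx add_col_mx add_block_mx !addr0 !add0r -!scalar_mxM -!raddfD /=.
have -> : (c * c + - s * - s = 1)%R by rewrite mulrNN.
have -> : (c * s + - s * c = 0)%R by ring.
have -> : (s * c + c * - s = 0)%R by ring.
have -> : (s * s + c * c = 1)%R by rewrite addrC.
by rewrite raddf0 row_mx0 col_mx0 -!scalar_mx_block.
Qed.

Let rot_mx_col d (c s x y : R) (z : 'cV[R]_d) :
  rot_mx d c s *m col_mx (const_mx x : 'cV_1) (col_mx (const_mx y : 'cV_1) z) =
  col_mx (const_mx (c * x - s * y)%R) (col_mx (const_mx (s * x + c * y)%R) z).
Proof.
rewrite /rot_mx mul_block_col mul_row_col mul_col_mx mul_block_col.
rewrite !mul0mx !mul1mx addr0 add_col_mx !add0r addr0.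
congr col_mx; last congr col_mx.
- by apply/matrixP => i j; rewrite !mxE !ord1 !big_ord1 !mxE !eqxx !mulr1n mulNr.
- by apply/matrixP => i j; rewrite !mxE !ord1 !big_ord1 !mxE !eqxx !mulr1n.
Qed.

Lemma rot_mx_consv d (c s x y : R) (z : 'cV[R]_d) :
  (rot_mx d c s : 'M[R]_d.+2) *m consv (x, consv (y, z)) =
  consv ((c * x - s * y)%R, consv ((s * x + c * y)%R, z)).
Proof. exact: rot_mx_col. Qed.

Lemma std_invariant_rot d (c s : R) : (c ^+ 2 + s ^+ 2 = 1)%R ->
  std_invariant (rot_mx d c s : 'M[R]_d.+2).
Proof.
move=> cs; split=> [|f mf f0]; first exact: rot_mx_orthogonal.
(* Integrating out the coordinates that the rotation fixes leaves a planar function, to which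
   [gauss_rot] applies. *)
pose F (f : 'cV[R]_d.+2 -> \bar R) (p : measurableTypeR R * measurableTypeR R) :=
  \int[std_normal R d]_z f (consv (p.1, consv (p.2, z))).
have mF (g : 'cV[R]_d.+2 -> \bar R) : measurable_fun setT g ->
    (forall z, 0 <= g z) -> measurable_fun setT (F g).
  move=> mg g0; pose h (q : (measurableTypeR R * measurableTypeR R) * 'cV[R]_d) :=
    g (consv (q.1.1, consv (q.1.2, q.2))).
  apply: (measurable_fun_fubini_tonelli_F h); last by move=> x; exact: g0.
  apply: (measurableT_comp mg); apply: (measurableT_comp (@measurable_consv R _)).
  apply/measurable_fun_pairP; split => /=.
    exact: (measurableT_comp measurable_fst measurable_fst).
  apply: (measurableT_comp (@measurable_consv R _)).
  apply/measurable_fun_pairP; split => /=; last exact: measurable_snd.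
  exact: (measurableT_comp measurable_snd measurable_fst).
have FE (g : 'cV[R]_d.+2 -> \bar R) : measurable_fun setT g -> (forall z, 0 <= g z) ->
    \int[std_normal R d.+2]_z g z = \int[N01 \x N01]_p F g p.
  move=> mg g0; rewrite ge0_integral_std_normalS// fubini_tonelli1//; first last.
  - by move=> p; exact: integral_ge0.
  - exact: mF.
  apply: eq_integral => x _; rewrite ge0_integral_std_normalS//.
  apply: (measurableT_comp mg); apply: (measurableT_comp (@measurable_consv R _)).
  exact: pair1_measurable.
rewrite !FE//; last exact: measurableT_comp mf (measurable_mulmx _).
rewrite -(gauss_rot cs (f := F f)); last 2 first.
- exact: mF.
- by move=> p; exact: integral_ge0.
apply: eq_integral => -[x y] _; rewrite /F/=.
by apply: eq_integral => z _; rewrite rot_mx_consv.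
Qed.

(** The sign change is handled by evenness of the density and reflection invariance of Lebesgue
    measure. *)
Lemma std_invariant1 (a : R) : (a ^+ 2 = 1)%R -> std_invariant (a%:M : 'M[R]_1).
Proof.
move=> a2; split=> [|f mf f0]; first by rewrite tr_scalar_mx -scalar_mxM -expr2 a2.
have mfc : measurable_fun setT (fun x => f (consv (x, 0%R))).
  apply: (measurableT_comp mf); apply: (measurableT_comp (@measurable_consv R _)).
  exact: pair2_measurable.
have FE (g : 'cV[R]_1 -> \bar R) : measurable_fun setT g -> (forall z, 0 <= g z) ->
    \int[std_normal R 1]_z g z = \int[N01]_x g (consv (x, 0%R)).
  move=> mg g0; rewrite ge0_integral_std_normalS//; apply: eq_integral => x _.
  rewrite integral_dirac//=; first by rewrite diracT mul1e.
  apply: (measurableT_comp mg); apply: (measurableT_comp (@measurable_consv R _)).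
  exact: pair1_measurable.
rewrite !FE//; last exact: measurableT_comp mf (measurable_mulmx _).
have [->|->] : a = 1%R \/ a = (-1)%R.
  by move/eqP: a2; rewrite sqrf_eq1 => /orP[]/eqP; [left|right].
  by apply: eq_integral => x _; rewrite mul1mx.
pose g (x : R) := f (consv (x, 0%R)) * (normal_pdf 0 1 x)%:E.
have mg : measurable_fun setT g.
  by apply: emeasurable_funM => //; apply/measurable_EFinP; exact: measurable_normal_pdf.
have g0 x : 0 <= g x by rewrite mule_ge0// lee_fin normal_pdf_ge0.
rewrite ge0_integral_normal_prob//.
rewrite ge0_integral_normal_prob//.
transitivity (\int[@lebesgue_measure R]_x g (- x)%R); last exact: ge0_integral_opp.
apply: eq_integral => x _; rewrite /g; congr (f _ * _%:E).
  rewrite mul_scalar_mx scaleN1r /consv; apply/matrixP => i j.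
  by rewrite !mxE; case: fintype.split => k; rewrite !mxE ?oppr0.
by rewrite /normal_pdf oner_eq0 /normal_fun !subr0 sqrrN.
apply: (measurableT_comp mf); apply: (measurableT_comp (measurable_mulmx _)).
apply: (measurableT_comp (@measurable_consv R _)); exact: pair2_measurable.
Qed.

End std_normal_invariance.

(** * Invariance under the whole orthogonal group *)

Section std_normal_orthogonal.
Variable R : realType.

Let usub_lsub m1 m2 n1 n2 (A : 'M[R]_(m1 + m2, n1 + n2)) :
  usubmx (lsubmx A) = ulsubmx A.
Proof. by apply/matrixP => i j; rewrite !mxE. Qed.

Let dsub_lsub m1 m2 n1 n2 (A : 'M[R]_(m1 + m2, n1 + n2)) :
  dsubmx (lsubmx A) = dlsubmx A.
Proof. by apply/matrixP => i j; rewrite !mxE. Qed.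

(** Induction on the dimension: a Householder matrix [H] on all but the first coordinate and then
    one plane rotation [Q] bring the first column to the first axis. What remains is block diagonal,
    and the induction hypothesis covers both [H] and the remaining block. *)
Lemma std_normal_orthogonal d (O : 'M[R]_d) : O *m O^T = 1%:M -> std_invariant O.
Proof.
elim: d O => [|d IHd] O OO.
  by split=> // f _ _; apply: eq_integral => z _; rewrite !flatmx0.
case: d IHd O OO => [|d] IHd O OO.
  rewrite (mx11_scalar O); apply: std_invariant1.
  have := OO; rewrite (mx11_scalar O) tr_scalar_mx -scalar_mxM.
  by move=> /matrixP/(_ 0%R 0%R); rewrite !mxE eqxx !mulr1n expr2.
pose P : 'M[R]_(1 + d.+1) := O.
have PP : P *m P^T = 1%:M by [].
have PtP := orthogonal_trK PP.
pose v := lsubmx P.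
have v1 : sqnorm2 v = 1%R.
  rewrite sqnorm2E; have /matrixP/(_ (lshift _ 0) (lshift _ 0))%R := PtP.
  rewrite [in X in _ = X -> _]mxE eqxx mulr1n => <-.
  by rewrite !mxE; apply: eq_bigr => i _; rewrite !mxE.
have vP : lsubmx P = v by [].
clearbody v; pose w := dsubmx v; have [H HH Hw] := householder w.
set r := Num.sqrt _ in Hw.
have x2r2 : ((v (lshift _ 0) 0) ^+ 2 + r ^+ 2 = 1)%R.
  rewrite /r sqr_sqrtr ?sqnorm2_ge0// -v1 /sqnorm2 big_split_ord big_ord1.
  by congr (_ + _)%R; apply: eq_bigr => i _; rewrite /w mxE.
set x := v (lshift _ 0) 0 in x2r2.
have vE : v = consv (x, w).
  rewrite -[LHS]vsubmxK; congr col_mx.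
  by apply/matrixP => i j; rewrite !ord1 !mxE.
have reE : r *: delta_mx 0 0 = consv (r, 0) :> 'cV[R]_d.+1.
  apply/matrixP => i j; rewrite ord1 /consv.
  have [k ->|k ->] := split_ordP (i : 'I_(1 + d)).
    by rewrite (@col_mxEu _ 1 d 1) !mxE ord1 -!val_eqE /= mulr1.
  by rewrite (@col_mxEd _ 1 d 1) !mxE -!val_eqE /= mulr0.
clearbody x w r.
pose B : 'M[R]_(1 + d.+1) := block_mx (1%:M : 'M[R]_1) 0 0 H.
have iB : std_invariant (B : 'M[R]_d.+2) by exact/std_invariant_block/IHd.
(* The first column is now [(x, r, 0)] of norm one, so the rotation with cosine [x] and sine [- r]
   sends it to the first axis. *)
pose Q : 'M[R]_(1 + d.+1) := rot_mx d x (- r).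
have iQ : std_invariant (Q : 'M[R]_d.+2) by apply: std_invariant_rot; rewrite sqrrN.
pose M : 'M[R]_(1 + d.+1) := Q *m (B *m P).
have [QB _] := std_invariantM iQ iB.
have ME : M = Q *m B *m P by rewrite /M mulmxA.
have MM : M *m M^T = 1%:M.
  by rewrite ME trmx_mul mulmxA -(mulmxA _ P) PP mulmx1.
have Mv : lsubmx M = col_mx 1%:M 0.
  rewrite /M -!mulmx_lsub vP vE.
  have -> : B *m consv (x, w) = consv (x, consv (r, 0)).
    by rewrite -reE -Hw; exact: block1_consv.
  have -> : Q *m consv (x, consv (r, 0)) = consv (1, 0) :> 'cV[R]_(1 + d.+1).
    transitivity (consv (x * x - - r * r, consv (- r * x + x * r, 0 : 'cV[R]_d))).
      exact: rot_mx_consv.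
    rewrite mulNr opprK -!expr2 x2r2 (_ : - r * x + x * r = 0); last by ring.
    congr consv; congr pair.
    by rewrite -[LHS]/(col_mx _ _) /= (_ : const_mx 0 = 0)// col_mx0.
  by congr col_mx; apply/matrixP => i j; rewrite !ord1 !mxE eqxx.
have MtM := orthogonal_trK MM.
(* The first column of [M^T M = 1] shows that the first row of [M] is the first axis too. *)
have MtE : lsubmx M^T = col_mx 1%:M 0.
  have /(congr1 lsubmx) := MtM; rewrite -mulmx_lsub Mv -[in LHS](hsubmxK M^T).
  rewrite mul_row_col mulmx1 mulmx0 addr0 => ->.
  by rewrite scalar_mx_block block_mxEh row_mxKl.
have MB : M = block_mx (1%:M : 'M[R]_1) 0 0 (drsubmx M).
  rewrite -[LHS]submxK; congr block_mx.
  - by rewrite -usub_lsub Mv col_mxKu.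
  - rewrite -[LHS]trmxK trmx_ursub.
    by rewrite -dsub_lsub MtE col_mxKd trmx0.
  - by rewrite -dsub_lsub Mv col_mxKd.
have iM : std_invariant (M : 'M[R]_d.+2).
  rewrite MB; apply/std_invariant_block/IHd.
  have := MM; rewrite MB tr_block_mx mulmx_block !trmx1 !trmx0 !mulmx0 !mul0mx.
  rewrite !addr0 !add0r scalar_mx_block block_mxKdr => /eq_block_mx[_ _ _ <-].
  by [].
have -> : O = (Q *m B)^T *m M by rewrite ME mulmxA orthogonal_trK// mul1mx.
by apply: std_invariantM => //; apply/std_invariantV/std_invariantM.
Qed.

End std_normal_orthogonal.

(** * Second moment of the standard normal law *)

Section second_moment.
Variable R : realType.
Local Notation mu := (@lebesgue_measure R).

Let e (x : R) : R := expR (- x ^+ 2 / 2).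

Let e_ge0 x : 0 <= e x. Proof. exact: expR_ge0. Qed.

(** The primitive [x e(x)] vanishes at [0] and at infinity, which is why [x^2 e] and [e] have equal
    integrals over the half line. *)
Let is_derive_xe (x : R) : is_derive x 1 (fun y => y * e y) ((1 - x ^+ 2) * e x).
Proof.
have id1 : is_derive x (1 : R) (@id R) (1 : R) := is_derive_id x 1.
have d1 := is_deriveM id1 id1.
have d2 : is_derive x 1 (fun y : R => - y ^+ 2 / 2) (- x).
  have := is_deriveZ (- 2^-1) d1.
  rewrite (_ : _ \*: _ = (fun y : R => - y ^+ 2 / 2)); last first.
    by apply/funext => y; rewrite /= /GRing.scale /= !fctE /=; field.
  by move=> h; apply: (is_derive_eq h); rewrite /GRing.scale /=; field.
have d3 := @is_derive1_comp _ expR (fun y : R => - y ^+ 2 / 2) x _ _ (is_derive_expR _) d2.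
apply: (is_derive_eq (is_deriveM id1 d3)).
by rewrite /GRing.scale /= /e; ring.
Qed.

Let cont_e : continuous e.
Proof.
move=> x; apply: continuous_comp; last exact: continuous_expR.
by apply: cvgM; [apply: cvgN; exact: exprn_continuous|exact: cvg_cst].
Qed.

Let cont_xe : continuous (fun y : R => y * e y).
Proof. by move=> x; apply: cvgM => //; exact: cont_e. Qed.

Let cont_x2e (a b : R) : continuous (fun y : R => (a + b * y ^+ 2) * e y).
Proof.
move=> x; apply: cvgM; last exact: cont_e.
by apply: cvgD; [exact: cvg_cst|apply: cvgM; [exact: cvg_cst|exact: exprn_continuous]].
Qed.

Let cvg_xe : (x : R) * e x @[x --> +oo] --> (0 : R).
Proof.
apply/cvgr0Pnorm_lt => eps eps0; near=> x.
have x0 : 0 < x by near: x; apply: nbhs_pinfty_gt; rewrite ?num_real.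
(* From [exp(x^2/2) >= 1 + x^2/2] one gets [x e(x) < 2/x], hence this threshold. *)
have xe : 2 / eps < x by near: x; apply: nbhs_pinfty_gt; rewrite ?num_real.
have xe0 : 0 <= x * e x by rewrite mulr_ge0// ltW.
rewrite (ger0_norm xe0) /e mulNr expRN ltr_pdivrMr ?expR_gt0//.
have := expR_ge1Dx (x ^+ 2 / 2).
rewrite ltr_pdivrMr// in xe.
have : 2 * x < x * eps * x by rewrite ltr_pM2r.
rewrite expr2 => h1 h2.
have : eps * (1 + x * x / 2) <= eps * expR (x * x / 2) by rewrite ler_pM2l.
by nra.
Unshelve. all: by end_near.
Qed.

Let d_xe x : (fun y : R => y * e y)^`()%classic x = (1 - x ^+ 2) * e x.
Proof. by rewrite derive1E; have /@derive_val -> := is_derive_xe x. Qed.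

Let derivable_xe x : derivable (fun y : R => y * e y) x 1.
Proof. by have /@ex_derive := is_derive_xe x. Qed.

Let int_01 : (\int[mu]_(x in `[0%R, 1%R]) ((1 - x ^+ 2) * e x)%:E = (e 1)%:E)%E.
Proof.
rewrite (@continuous_FTC2 _ _ (fun y => y * e y))//.
- by rewrite mul1r mul0r sube0.
- apply: continuous_subspaceT => x; have := @cont_x2e 1 (-1) x.
  by under eq_fun do rewrite mulN1r.
- split => //.
  + by apply: cvg_at_right_filter; exact: cont_xe.
  + by apply: cvg_at_left_filter; exact: cont_xe.
Qed.

Let int_1y : (\int[mu]_(x in `[1%R, +oo[) ((x ^+ 2 - 1) * e x)%:E = (e 1)%:E)%E.
Proof.
rewrite (@ge0_continuous_FTC2y _ _ (fun y => - (y * e y)) 1 0).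
- by rewrite mul1r sub0e -EFinN opprK.
- by move=> x x1; rewrite mulr_ge0// subr_ge0 expr_ge1// (le_trans _ x1).
- apply: continuous_subspaceT => x; have := @cont_x2e (-1) 1 x.
  by under eq_fun do rewrite mul1r addrC.
- by rewrite -[X in _ --> X]oppr0; apply: cvgN; exact: cvg_xe.
- by move=> x _; apply: derivableN; exact: derivable_xe.
- by apply: cvg_at_right_filter; apply: cvgN; exact: cont_xe.
- move=> x _; rewrite derive1E deriveN; last exact: derivable_xe.
  rewrite -derive1E d_xe; ring.
Qed.

Let split_at1 (f : R -> R) : continuous f -> (forall x, 0 <= f x) ->
  (\int[mu]_(x in `[0%R, +oo[) (f x)%:E =
   \int[mu]_(x in `[0%R, 1%R]) (f x)%:E + \int[mu]_(x in `[1%R, +oo[) (f x)%:E)%E.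
Proof.
move=> cf f0.
have mf D : measurable_fun D (EFin \o f).
  by apply/measurable_funTS/measurable_EFinP; exact: continuous_measurable_fun.
rewrite -[X in _ = (_ + X)%E]integral_itv_obnd_cbnd; last exact: mf.
rewrite (@itv_bndbnd_setU _ _ _ (BRight 1%R)) ?bnd_simp//.
apply: ge0_integral_setU => //; [exact: mf|by move=> x _; rewrite lee_fin|].
apply/disj_set2P; rewrite -subset0 => x [/=]; rewrite !in_itv/= => /andP[_ x1].
by rewrite ltNge x1.
Qed.

(** Since [(1 - x^2) e] changes sign at [1], the half line is cut there to keep all integrands
    nonnegative; the boundary value [e 1] then occurs on both sides. *)
Let half_moment :
  (\int[mu]_(x in `[0%R, +oo[) (x ^+ 2 * e x)%:E = \int[mu]_(x in `[0%R, +oo[) (e x)%:E)%E.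
Proof.
have c2 : continuous (fun x : R => x ^+ 2 * e x).
  by move=> x; have := @cont_x2e 0 1 x; under eq_fun do rewrite add0r mul1r.
have m (f : R -> R) D : continuous f -> measurable_fun D (EFin \o f).
  by move=> cf; apply/measurable_funTS/measurable_EFinP; exact: continuous_measurable_fun.
have c1 : continuous (fun x : R => (1 - x ^+ 2) * e x).
  by move=> x; have := @cont_x2e 1 (-1) x; under eq_fun do rewrite mulN1r.
have c1' : continuous (fun x : R => (x ^+ 2 - 1) * e x).
  by move=> x; have := @cont_x2e (-1) 1 x; under eq_fun do rewrite mul1r addrC.
have x2e0 x : 0 <= x ^+ 2 * e x by rewrite mulr_ge0// sqr_ge0.
rewrite !split_at1//.
have -> : (\int[mu]_(x in `[0%R, 1%R]) (e x)%:E =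
    \int[mu]_(x in `[0%R, 1%R]) (x ^+ 2 * e x)%:E + (e 1)%:E)%E.
  rewrite -int_01 -ge0_integralD//.
  - by apply: eq_integral => x _; rewrite -EFinD; congr _%:E; ring.
  - by move=> x _; rewrite lee_fin.
  - exact: m c2.
  - move=> x /=; rewrite in_itv/= => /andP[x0 x1].
    by rewrite lee_fin mulr_ge0// subr_ge0 expr_le1.
  - exact: m c1.
have -> : (\int[mu]_(x in `[1%R, +oo[) (x ^+ 2 * e x)%:E =
    \int[mu]_(x in `[1%R, +oo[) (e x)%:E + (e 1)%:E)%E.
  rewrite -int_1y -ge0_integralD//.
  - by apply: eq_integral => x _; rewrite -EFinD; congr _%:E; ring.
  - by move=> x _; rewrite lee_fin.
  - exact: m cont_e.
  - move=> x /=; rewrite in_itv/= andbT => x1.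
    by rewrite lee_fin mulr_ge0// subr_ge0 expr_ge1// (le_trans _ x1).
  - exact: m c1'.
by rewrite addeA addeAC.
Qed.

Lemma second_moment_normal_prob :
  (\int[normal_prob (0 : R) 1]_x (x ^+ 2)%:E = 1)%E.
Proof.
rewrite ge0_integral_normal_prob; last 2 first.
- by apply/measurable_EFinP; exact: exprn_measurable.
- by move=> x; rewrite lee_fin sqr_ge0.
rewrite -(integral_normal_pdf (0 : R) 1).
have pdfE x : normal_pdf (0 : R) 1 x = normal_peak 1 * e x.
  by rewrite /normal_pdf oner_eq0 /normal_fun subr0 expr1n.
have pk0 : (0 <= (normal_peak (1 : R))%:E)%E by rewrite lee_fin normal_peak_ge0.
have c2 : continuous (fun x : R => x ^+ 2 * e x).
  by move=> x; have := @cont_x2e 0 1 x; under eq_fun do rewrite add0r mul1r.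
have x2e0 x : 0 <= x ^+ 2 * e x by rewrite mulr_ge0// sqr_ge0.
transitivity ((normal_peak 1)%:E * \int[mu]_x (x ^+ 2 * e x)%:E)%E.
  rewrite -ge0_integralZl//; last 2 first.
  - by apply/measurable_EFinP; exact: continuous_measurable_fun.
  - by move=> x _; rewrite lee_fin.
  by apply: eq_integral => x _; rewrite pdfE -!EFinM mulrCA.
transitivity ((normal_peak 1)%:E * \int[mu]_x (e x)%:E)%E; last first.
  rewrite -ge0_integralZl//; last 2 first.
  - by apply/measurable_EFinP; exact: continuous_measurable_fun.
  - by move=> x _; rewrite lee_fin.
  by apply: eq_integral => x _; rewrite pdfE.
rewrite !ge0_symfun_integralT//; first by rewrite -set_itvcy half_moment.
- by move=> x; rewrite /e /= sqrrN.
- by move=> x; rewrite /e /= sqrrN.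
Qed.

End second_moment.

(** * Multivariate normal laws *)

Section gaussian_law.
Variable R : realType.

Lemma ge0_integral_normal_law d (mu : 'cV[R]_d) (S : 'M[R]_d) (f : 'cV[R]_d -> \bar R) :
  measurable_fun setT f -> (forall z, (0 <= f z)%E) ->
  (\int[normal_law mu S]_z f z = \int[std_normal R d]_z f (mu + psd_sqrt S *m z)%R)%E.
Proof.
move=> mf f0; have ma := measurable_affinev mu (psd_sqrt S).
rewrite -[RHS]/(\int[_]_(z in affinev mu (psd_sqrt S) @^-1` setT)
  (f \o affinev mu (psd_sqrt S)) z)%E.
by rewrite -(ge0_integral_pushforward ma).
Qed.

(** From [A A^T = r r] the matrix [r^-1 A] is orthogonal, and rotation invariance absorbs it. *)
Lemma ge0_integral_normal_law_factor d (mu : 'cV[R]_d) (S A : 'M[R]_d)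
    (f : 'cV[R]_d -> \bar R) : posdef S -> A *m A^T = S ->
  measurable_fun setT f -> (forall z, (0 <= f z)%E) ->
  (\int[normal_law mu S]_z f z = \int[std_normal R d]_z f (mu + A *m z)%R)%E.
Proof.
move=> Spd AA mf f0; have [[rT _] rr] := psd_sqrtP (posdef_psd Spd).
rewrite ge0_integral_normal_law//.
set r := psd_sqrt S in rT rr *.
have ru : r \in unitmx.
  by have := posdef_unitmx Spd; rewrite -rr unitmx_mul => /andP[].
have OO : (invmx r *m A) *m (invmx r *m A)^T = 1%:M.
  rewrite trmx_mul trmx_inv rT mulmxA -(mulmxA (invmx r)) AA -rr mulmxA mulVmx//.
  by rewrite mul1mx mulmxV.
have [_ <-] := std_normal_orthogonal OO; last 2 first.
- exact: (measurableT_comp mf (measurable_affinev mu r)).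
- by move=> z.
by apply: eq_integral => z _; rewrite mulmxA mulKVmx.
Qed.

Lemma measurable_sqnorm2 d : measurable_fun setT (@sqnorm2 R d).
Proof.
apply: measurable_sum => i; apply: measurable_funX; exact: measurable_entry.
Qed.

(** A rotation turns [c] onto the first axis, leaving the one-dimensional second moment. *)
Lemma std_normal_dot_sqr d (c : 'rV[R]_d) :
  (\int[std_normal R d]_z (((c *m z) 0 0) ^+ 2)%:E = ((c *m c^T) 0 0)%:E)%E.
Proof.
case: d c => [|d] c.
  rewrite (_ : c = 0) ?mul0mx ?mxE; last exact: thinmx0.
  under eq_integral do rewrite mul0mx mxE expr0n.
  by rewrite integral0.
have [ O OO Oc] := householder c^T.
have OtO := orthogonal_trK OO.
have cE z : (c *m z) 0 0 = Num.sqrt (sqnorm2 c^T) * (O *m z) 0 0.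
  have -> : c *m z = (O *m c^T)^T *m (O *m z).
    by rewrite trmx_mul trmxK mulmxA -(mulmxA c) OtO mulmx1.
  by rewrite Oc trmxZ trmx_delta -scalemxAl mxE -rowE mxE.
have m0 : measurable_fun setT (fun z : 'cV[R]_d.+1 => ((z 0 0) ^+ 2)%:E).
  by apply/measurable_EFinP/measurable_funX; exact: measurable_entry.
under eq_integral do rewrite cE exprMn sqr_sqrtr ?sqnorm2_ge0// EFinM.
rewrite ge0_integralZl//; first last.
- by rewrite lee_fin sqnorm2_ge0.
- by move=> z _; rewrite lee_fin sqr_ge0.
- exact: (measurableT_comp m0 (measurable_mulmx O)).
have [_ /(_ (fun z : 'cV[R]_d.+1 => ((z 0 0) ^+ 2)%:E)) ->//] :=
  std_normal_orthogonal OO; last first.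
  by move=> z; rewrite lee_fin sqr_ge0.
rewrite ge0_integral_std_normalS//; last by move=> z; rewrite lee_fin sqr_ge0.
have cE0 (x : R) (z : 'cV[R]_d) : consv (x, z) 0 0 = x.
  have -> : 0 = lshift d 0 :> 'I_(1 + d) by apply/val_inj.
  by rewrite /consv (@col_mxEu _ 1 d 1) mxE.
under eq_integral => x _.
  under eq_integral => z _ do rewrite cE0.
  rewrite integral_cst//= probability_setT mule1.
  over.
rewrite second_moment_normal_prob mule1 sqnorm2E trmxK//.
Qed.

Lemma std_normal_sqnorm2 m d (C : 'M[R]_(m, d)) :
  (\int[std_normal R d]_z (sqnorm2 (C *m z))%:E = (\tr (C *m C^T))%:E)%E.
Proof.
rewrite /sqnorm2; under eq_integral do rewrite -sumEFin.
rewrite ge0_integral_sum//; last 2 first.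
- move=> i; apply/measurable_EFinP/measurable_funX.
  exact: (measurableT_comp (measurable_entry i 0) (measurable_mulmx C)).
- by move=> i z _; rewrite lee_fin sqr_ge0.
rewrite /mxtrace -sumEFin; apply: eq_bigr => i _.
transitivity (\int[std_normal R d]_z (((row i C *m z) 0 0) ^+ 2)%:E)%E.
  by apply: eq_integral => z _; rewrite -row_mul [in RHS]mxE.
rewrite std_normal_dot_sqr; congr _%:E.
by rewrite !mxE; apply: eq_bigr => k _; rewrite !mxE.
Qed.

Lemma measurable_mx_sqnorm2 m d (C : 'M[R]_(m, d)) (mu : 'cV[R]_d) :
  measurable_fun setT (fun z : 'cV[R]_d => (sqnorm2 (C *m (z - mu)))%:E).
Proof.
apply/measurable_EFinP; apply: (measurableT_comp (@measurable_sqnorm2 m)).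
apply: (measurableT_comp (measurable_mulmx C)).
apply: measurable_fun_mx => i j; under eq_fun do rewrite !mxE.
by apply: measurable_funD => //; exact: measurable_entry.
Qed.

Lemma normal_law_sqnorm2 m d (C : 'M[R]_(m, d)) (mu : 'cV[R]_d) (S : 'M[R]_d) :
  psd S ->
  (\int[normal_law mu S]_z (sqnorm2 (C *m (z - mu)))%:E = (\tr (C *m S *m C^T))%:E)%E.
Proof.
move=> S0; have [[rT _] rr] := psd_sqrtP S0.
rewrite ge0_integral_normal_law; last 2 first.
- exact: measurable_mx_sqnorm2.
- by move=> z; rewrite lee_fin sqnorm2_ge0.
under eq_integral do rewrite addrC addKr mulmxA.
rewrite std_normal_sqnorm2 trmx_mul rT; congr (\tr _)%:E.
by rewrite mulmxA -(mulmxA C) rr.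
Qed.

(** The centre [nu] is independent of the mean because laws in the ball may have a mean other than
    that of the reference law. *)
Lemma normal_law_sqnorm2_lty m d (C : 'M[R]_(m, d)) (mu nu : 'cV[R]_d) (S : 'M[R]_d) :
  psd S -> (\int[normal_law mu S]_z (sqnorm2 (C *m (z - nu)))%:E < +oo)%E.
Proof.
move=> S0; have sqnorm2D k (u v : 'cV[R]_k) :
    sqnorm2 (u + v) <= 2 * sqnorm2 u + 2 * sqnorm2 v.
  rewrite /sqnorm2 !mulr_sumr -big_split /=; apply: ler_sum => i _.
  rewrite mxE; have := sqr_ge0 (u i 0 - v i 0); nra.
pose g z : \bar R :=
  (2%:E * (sqnorm2 (C *m (z - mu)))%:E + (2 * sqnorm2 (C *m (mu - nu)))%:E)%E.
apply: (@le_lt_trans _ _ (\int[normal_law mu S]_z g z)%E).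
  apply: ge0_le_integral => //.
  - by move=> z _; rewrite lee_fin sqnorm2_ge0.
  - exact: measurable_mx_sqnorm2.
  - apply: emeasurable_funD => //; apply: emeasurable_funM => //.
    exact: measurable_mx_sqnorm2.
  - move=> z _; rewrite /g -EFinM -EFinD lee_fin.
    by rewrite -[z - nu](subrKA mu) mulmxDr sqnorm2D.
rewrite ge0_integralD//.
- rewrite ge0_integralZl//.
  + by rewrite normal_law_sqnorm2// integral_cst//= probability_setT mule1 -EFinM -EFinD ltry.
  + exact: measurable_mx_sqnorm2.
  + by move=> z _; rewrite lee_fin sqnorm2_ge0.
- by move=> z _; rewrite -EFinM lee_fin mulr_ge0// sqnorm2_ge0.
- by apply: emeasurable_funM => //; exact: measurable_mx_sqnorm2.
- by move=> z _; rewrite lee_fin mulr_ge0// sqnorm2_ge0.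
Qed.

(** [M S^(1/2)] is another factor of [S]. *)
Lemma normal_law_invariant d (mu : 'cV[R]_d) (S M : 'M[R]_d) (f : 'cV[R]_d -> \bar R) :
  posdef S -> M *m S *m M^T = S ->
  measurable_fun setT f -> (forall z, (0 <= f z)%E) ->
  (\int[normal_law mu S]_z f (mu + M *m (z - mu))%R = \int[normal_law mu S]_z f z)%E.
Proof.
move=> Spd MSM mf f0; have [[rT _] rr] := psd_sqrtP (posdef_psd Spd).
rewrite ge0_integral_normal_law//; last first.
  apply: (measurableT_comp mf); apply: (measurableT_comp (measurable_affinev mu M)).
  apply: measurable_fun_mx => i j; under eq_fun do rewrite !mxE.
  by apply: measurable_funD => //; exact: measurable_entry.
rewrite (@ge0_integral_normal_law_factor _ _ _ (M *m psd_sqrt S))//; last first.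
  by rewrite trmx_mul rT mulmxA -(mulmxA M) rr.
by apply: eq_integral => z _; rewrite [X in M *m X]addrC addKr mulmxA.
Qed.

End gaussian_law.

(** * Mean square error of an arbitrary estimator *)

Section mse_bound.
Variables (R : realType) (n m : nat).
Implicit Types (S : 'M[R]_(n + m)) (psi : 'cV[R]_m -> 'cV[R]_n).

Lemma mseE (Q : probability 'cV[R]_(n + m) R) psi :
  mse Q psi = (\int[Q]_z (sqnorm2 (usubmx z - psi (dsubmx z)))%:E)%E.
Proof. by rewrite /mse unlock. Qed.

Lemma measurable_usubmx : measurable_fun setT (@usubmx R n m 1).
Proof.
by apply: measurable_fun_mx => i j; under eq_fun do rewrite mxE; exact: measurable_entry.
Qed.

Lemma measurable_dsubmx : measurable_fun setT (@dsubmx R n m 1).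
Proof.
by apply: measurable_fun_mx => i j; under eq_fun do rewrite mxE; exact: measurable_entry.
Qed.

Lemma measurable_sqerror psi : estimators psi ->
  measurable_fun setT (fun z => (sqnorm2 (usubmx z - psi (dsubmx z)))%:E).
Proof.
move=> mpsi; apply/measurable_EFinP; apply: (measurableT_comp (@measurable_sqnorm2 R n)).
apply: measurable_fun_mx => i j; under eq_fun do rewrite mxE [X in _ + X]mxE.
apply: measurable_funB.
  exact: (measurableT_comp (measurable_entry i j) measurable_usubmx).
exact: (measurableT_comp (measurable_entry i j) (measurableT_comp mpsi measurable_dsubmx)).
Qed.

Lemma sqnorm2_parallelogram d (u v : 'cV[R]_d) :
  sqnorm2 (u + v) + sqnorm2 (u - v) = 2 * sqnorm2 u + 2 * sqnorm2 v.
Proof.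
rewrite /sqnorm2 -big_split /= !mulr_sumr -big_split /=.
by apply: eq_bigr => i _; rewrite !mxE; ring.
Qed.

(* The reflection [M] of the error [e = errmx (gain S) *m (z - mu)] fixes the
   observation and preserves [N(mu, S)], and averaging the squared error of an
   estimator over [e] and [- e] only leaves a larger value than [|e|^2]. *)
Lemma mse_normal_law_ge (mu : 'cV[R]_(n + m)) S psi :
  posdef S -> drsubmx S \in unitmx -> estimators psi ->
  ((D_objective S)%:E <= mse (normal_law mu S) psi)%E.
Proof.
move=> Spd Su mpsi; have ST := Spd.1; set Q := normal_law mu S.
pose B := errmx (gain S).
pose J : 'M[R]_(n + m, n) := col_mx 1%:M 0.
(* [J] embeds the state [x]; as [B J = 1], this matrix negates the error [B (z - mu)], and it
   changes only the state coordinates. *)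
pose M : 'M[R]_(n + m) := 1%:M - 2 *: (J *m B).
pose Sch := B *m S *m B^T.
have SchT : Sch^T = Sch by rewrite /Sch !trmx_mul trmxK ST mulmxA.
have BJ : B *m J = 1%:M by rewrite mul_row_col mul1mx mulmx0 addr0.
have BS : B *m S = Sch *m J^T.
  (* The normal equations: the regression error is uncorrelated with the observation. *)
  have BS0 : B *m S = row_mx (ulsubmx S - gain S *m dlsubmx S) 0.
    by rewrite errmx_mulr mulmxKV// subrr.
  rewrite /Sch BS0 tr_row_mx tr_col_mx trmx1 trmx0 mul_row_col mul0mx addr0.
  by rewrite mulmx1 mul_mx_row mulmx1 mulmx0.
have MSM : M *m S *m M^T = S.
  have SB : S *m B^T = J *m Sch by rewrite -[S in LHS]ST -trmx_mul BS trmx_mul trmxK SchT.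
  have JB : J^T *m B^T = 1%:M by rewrite -trmx_mul BJ trmx1.
  pose C := J *m Sch *m J^T.
  have MS : M *m S = S - 2 *: C.
    by rewrite /M mulmxBl mul1mx -scalemxAl -mulmxA BS mulmxA.
  have SBJ : S *m (B^T *m J^T) = C by rewrite mulmxA SB.
  have CBJ : C *m (B^T *m J^T) = C by rewrite /C -!mulmxA (mulmxA J^T) JB mul1mx.
  rewrite MS /M trmxB trmx1 trmxZ trmx_mul mulmxBr mulmx1 mulmxBl -!scalemxAl.
  rewrite -!scalemxAr SBJ CBJ.
  by move: C {MS SBJ CBJ} => C; apply/matrixP => i j; rewrite !mxE; ring.
pose h z := (sqnorm2 (usubmx z - psi (dsubmx z)))%:E.
have mh : measurable_fun setT h by exact: measurable_sqerror.
have h0 z : (0 <= h z)%E by rewrite lee_fin sqnorm2_ge0.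
pose r (z : 'cV[R]_(n + m)) := mu + M *m (z - mu).
have mr : measurable_fun setT r.
  apply: (measurableT_comp (measurable_affinev mu M)).
  apply: measurable_fun_mx => i j; under eq_fun do rewrite !mxE.
  by apply: measurable_funD => //; exact: measurable_entry.
have hr : (\int[Q]_z h (r z) = \int[Q]_z h z)%E by exact: normal_law_invariant.
have rE z : r z = z - 2 *: (J *m (B *m (z - mu))).
  by rewrite /r /M mulmxBl mul1mx addrA addrCA subrr addr0 -scalemxAl mulmxA.
have ru z : usubmx (r z) = usubmx z - 2 *: (B *m (z - mu)).
  rewrite rE raddfB /= [usubmx (2 *: _)]linearZ /= -mul_usub_mx col_mxKu.
  by rewrite mul1mx.
have rd z : dsubmx (r z) = dsubmx z.
  rewrite rE raddfB /= [dsubmx (2 *: _)]linearZ /= -mul_dsub_mx col_mxKd.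
  by rewrite mul0mx scaler0 subr0.
have hh z : (2%:E * (sqnorm2 (B *m (z - mu)))%:E <= h z + h (r z))%E.
  rewrite /h ru rd -EFinM -EFinD lee_fin.
  set e := B *m _; set y := psi _; set x := usubmx z.
  have -> : x - y = (x - y - e) + e by rewrite subrK.
  have -> : x - 2 *: e - y = (x - y - e) - e.
    by apply/matrixP => i j; rewrite !mxE; ring.
  by rewrite sqnorm2_parallelogram lerDr mulr_ge0// sqnorm2_ge0.
have mB : measurable_fun setT (fun z : 'cV[R]_(n + m) => (sqnorm2 (B *m (z - mu)))%:E).
  exact: measurable_mx_sqnorm2.
have e0 (z : 'cV[R]_(n + m)) : (0 <= (sqnorm2 (B *m (z - mu)))%:E)%E.
  by rewrite lee_fin sqnorm2_ge0.
have : (\int[Q]_z (2%:E * (sqnorm2 (B *m (z - mu)))%:E) <= \int[Q]_z (h z + h (r z)))%E.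
  apply: ge0_le_integral => //.
  - by move=> z _; rewrite mule_ge0.
  - by apply: emeasurable_funM.
  - by apply: emeasurable_funD => //; exact: measurableT_comp mh mr.
rewrite ge0_integralZl// ge0_integralD//; last exact: measurableT_comp mh mr.
rewrite hr normal_law_sqnorm2; last exact: posdef_psd.
rewrite -D_objectiveE// mseE; set X := (\int[_]_z h z)%E.
have X0 : (0 <= X)%E by exact: integral_ge0.
have -> : (X + X = 2%:E * X)%E.
  have -> : 2%:E = (1 + 1 : \bar R)%E by rewrite -EFinD.
  by rewrite ge0_muleDl// mul1e.
by rewrite lee_pmul2l.
Qed.

End mse_bound.

(** * Couplings and the worst case of an affine estimator *)

Section coupling_bounds.
Variable R : realType.

Lemma W2_normal_law_le d (mu : 'cV[R]_d) (Sigma S : 'M[R]_d) (rho : R) :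
  posdef Sigma -> posdef S -> 0 <= rho -> bures Sigma S <= rho ^+ 2 ->
  (W2 (normal_law mu S) (normal_law mu Sigma) <= rho%:E)%E.
Proof.
move=> Sigmapd Spd rho0 b_le.
have [X [XX bE]] := bures_factor Sigmapd (posdef_psd Spd).
set r := psd_sqrt Sigma in bE.
pose c (z : 'cV[R]_d) := (affinev mu X z, affinev mu r z).
have mc : measurable_fun setT c.
  by apply/measurable_fun_pairP; split; exact: measurable_affinev.
pose cf : {mfun 'cV[R]_d >-> ('cV[R]_d * 'cV[R]_d)%type} :=
  HB.pack c (isMeasurableFun.Build _ _ _ _ c mc).
pose pi : probability ('cV[R]_d * 'cV[R]_d)%type R := distribution (std_normal R d) cf.
apply: ge_ereal_inf; exists ((\int[pi]_z (sqnorm2 (z.1 - z.2))%:E) `^ 2^-1)%E.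
  exists pi => //; split=> A mA.
    have mA' : measurable (affinev mu X @^-1` A).
      by rewrite -[X in measurable X]setTI; exact: (measurable_affinev mu X).
    transitivity (std_normal R d (affinev mu X @^-1` A)).
      by congr (std_normal R d _); apply/seteqP; split=> z //= [].
    transitivity (\int[normal_law mu S]_z (\1_A z)%:E)%E; last first.
      by rewrite integral_indic// setIT.
    (* [X] differs in general from the root that defines [normal_law mu S], so this marginal needs
       factor independence; the other one holds by definition. *)
    rewrite (ge0_integral_normal_law_factor _ Spd XX)//.
    - have := integral_indic (std_normal R d) measurableT mA'; rewrite setIT => <-.
      exact: eq_integral.
    - by apply/measurable_EFinP; exact: measurable_indic.
  by congr (std_normal R d _); apply/seteqP; split=> z //= [].
have -> : (\int[pi]_z (sqnorm2 (z.1 - z.2))%:E = (bures Sigma S)%:E)%E.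
  have mf : measurable_fun setT
      (fun z : 'cV[R]_d * 'cV[R]_d => (sqnorm2 (z.1 - z.2))%:E).
    apply/measurable_EFinP; apply: (measurableT_comp (@measurable_sqnorm2 R d)).
    apply: measurable_fun_mx => i j; under eq_fun do rewrite mxE [X in _ + X]mxE.
    apply: measurable_funB.
      exact: (measurableT_comp (measurable_entry i j) measurable_fst).
    exact: (measurableT_comp (measurable_entry i j) measurable_snd).
  rewrite -bE -std_normal_sqnorm2 /pi /distribution ge0_integral_pushforward//=.
    apply: eq_integral => z _; congr (sqnorm2 _)%:E.
    by rewrite /c /affinev /= mulmxBl opprD addrACA subrr add0r.
  by move=> z _; rewrite lee_fin sqnorm2_ge0.
have b0 : 0 <= bures Sigma S by rewrite -bE; exact/psd_tr_ge0/psd_gram.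
rewrite poweR12_sqrt ?lee_fin//= -[leRHS]ger0_norm// -sqrtr_sqr.
by rewrite ler_sqrt// sqr_ge0.
Qed.

Lemma integral_coupling1 d (Q P : probability 'cV[R]_d R) pi (f : 'cV[R]_d -> \bar R) :
  coupling Q P pi -> measurable_fun setT f -> (forall z, (0 <= f z)%E) ->
  (\int[pi]_z f z.1 = \int[Q]_z f z)%E.
Proof.
move=> [piQ _] mf f0.
rewrite -[LHS]/(\int[pi]_(z in fst @^-1` setT) (f \o fst) z)%E.
rewrite -(ge0_integral_pushforward measurable_fst)//.
apply: eq_measure_integral => A mA _; transitivity (pi (A `*` setT)); last exact: piQ.
by rewrite /pushforward; congr (pi _); apply/seteqP; split=> z //= [].
Qed.

Lemma integral_coupling2 d (Q P : probability 'cV[R]_d R) pi (f : 'cV[R]_d -> \bar R) :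
  coupling Q P pi -> measurable_fun setT f -> (forall z, (0 <= f z)%E) ->
  (\int[pi]_z f z.2 = \int[P]_z f z)%E.
Proof.
move=> [_ piP] mf f0.
rewrite -[LHS]/(\int[pi]_(z in snd @^-1` setT) (f \o snd) z)%E.
rewrite -(ge0_integral_pushforward measurable_snd)//.
apply: eq_measure_integral => A mA _; transitivity (pi (setT `*` A)); last exact: piP.
by rewrite /pushforward; congr (pi _); apply/seteqP; split=> z //= [].
Qed.

(* For [c = s / a], AM-GM gives [(f - g)^2 >= (1 - c) f^2 + (1 - 1/c) g^2],
   whose integral is [(a - s)^2]. *)
Lemma L2_distance_ge dd (T : measurableType dd) (P : probability T R)
    (f g : T -> R) (a s : R) :
  measurable_fun setT f -> measurable_fun setT g -> 0 <= a -> 0 < s ->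
  (\int[P]_x (f x ^+ 2)%:E = (a ^+ 2)%:E)%E ->
  (\int[P]_x (g x ^+ 2)%:E = (s ^+ 2)%:E)%E ->
  (((Num.max (a - s) 0) ^+ 2)%:E <= \int[P]_x ((f x - g x) ^+ 2)%:E)%E.
Proof.
move=> mf mg a0 s0 fa gs.
have int0 : (0 <= \int[P]_x ((f x - g x) ^+ 2)%:E)%E.
  by apply: integral_ge0 => x _; rewrite lee_fin sqr_ge0.
have [as_le|sa] := leP (a - s) 0; first by rewrite expr0n.
have a_gt0 : 0 < a by apply: lt_trans s0 _; rewrite -subr_gt0.
pose c := s / a.
have c0 : 0 < c by rewrite divr_gt0.
have c1 : c < 1 by rewrite ltr_pdivrMr// mul1r -subr_gt0.
have mf2 : measurable_fun setT (fun x => (f x ^+ 2)%:E).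
  by apply/measurable_EFinP; exact: measurable_funX.
have mg2 : measurable_fun setT (fun x => (g x ^+ 2)%:E).
  by apply/measurable_EFinP; exact: measurable_funX.
have mfg : measurable_fun setT (fun x => ((f x - g x) ^+ 2)%:E).
  by apply/measurable_EFinP; apply: measurable_funX; exact: measurable_funB.
have k1 : 0 <= 1 - c by rewrite subr_ge0 ltW.
have k2 : 0 <= c^-1 - 1 by rewrite subr_ge0 invf_ge1// ltW.
have : (\int[P]_x ((1 - c)%:E * (f x ^+ 2)%:E) <=
    \int[P]_x (((f x - g x) ^+ 2)%:E + (c^-1 - 1)%:E * (g x ^+ 2)%:E))%E.
  apply: ge0_le_integral => //.
  - by move=> x _; rewrite -EFinM lee_fin mulr_ge0// sqr_ge0.
  - exact: emeasurable_funM.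
  - by apply: emeasurable_funD => //; exact: emeasurable_funM.
  - move=> x _; rewrite -!EFinM -EFinD lee_fin -subr_ge0.
    rewrite (_ : _ - _ = (c * f x - g x) ^+ 2 / c); last first.
      by field; rewrite gt_eqF.
    by rewrite divr_ge0 ?sqr_ge0// ltW.
rewrite ge0_integralZl//; last by move=> x _; rewrite lee_fin sqr_ge0.
rewrite ge0_integralD//; last 3 first.
- by move=> x _; rewrite lee_fin sqr_ge0.
- by move=> x _; rewrite -EFinM lee_fin mulr_ge0// sqr_ge0.
- exact: emeasurable_funM.
rewrite ge0_integralZl//; last by move=> x _; rewrite lee_fin sqr_ge0.
(* An infinite distance is trivial; in the finite case the comparison takes place in the reals. *)
rewrite fa gs; move: int0; case: (\int[P]_x _)%E => [x _|_ _|//]; last by rewrite leey.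
rewrite -!EFinM -EFinD !lee_fin.
have -> : (1 - c) * a ^+ 2 = (a - s) ^+ 2 + (c^-1 - 1) * s ^+ 2.
  by rewrite /c; field; rewrite !gt_eqF.
by rewrite lerD2r.
Qed.

Lemma measurable_coord_sqr d (U : 'M[R]_d) (nu : 'cV[R]_d) i :
  measurable_fun setT (fun z : 'cV[R]_d => (U *m (z - nu)) i 0).
Proof.
apply: (measurableT_comp (measurable_entry i 0)).
apply: (measurableT_comp (measurable_mulmx U)).
apply: measurable_fun_mx => k j; under eq_fun do rewrite !mxE.
by apply: measurable_funD => //; exact: measurable_entry.
Qed.

(** An orthogonal change of coordinates splits the cost of any coupling into coordinate costs, each
    bounded by [L2_distance_ge] through the marginals alone. *)
Lemma W2_ge d (Q P : probability 'cV[R]_d R) (U : 'M[R]_d) (nu : 'cV[R]_d)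
    (a s : 'I_d -> R) (rho : R) :
  U *m U^T = 1%:M -> (forall i, 0 <= a i) -> (forall i, 0 < s i) ->
  (forall i, \int[Q]_z (((U *m (z - nu)) i 0) ^+ 2)%:E = (a i ^+ 2)%:E)%E ->
  (forall i, \int[P]_z (((U *m (z - nu)) i 0) ^+ 2)%:E = (s i ^+ 2)%:E)%E ->
  0 <= rho -> (W2 Q P <= rho%:E)%E ->
  \sum_i (Num.max (a i - s i) 0) ^+ 2 <= rho ^+ 2.
Proof.
move=> UU a0 s0 Qa Ps rho0; set T := \sum_i _ => W2_le.
have T0 : 0 <= T by apply: sumr_ge0 => i _; exact: sqr_ge0.
suff T_le : ((Num.sqrt T)%:E <= W2 Q P)%E.
  have := le_trans T_le W2_le; rewrite lee_fin => sT.
  by rewrite -[T]sqr_sqrtr// ler_sqr ?nnegrE ?sqrtr_ge0.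
apply: le_ereal_inf_tmp => _ [pi pi_c <-].
have int0 : (0 <= \int[pi]_z (sqnorm2 (z.1 - z.2))%:E)%E.
  by apply: integral_ge0 => z _; rewrite lee_fin sqnorm2_ge0.
rewrite poweR12_sqrt// -[X in (X <= _)%E]/(sqrte T%:E) lee_sqrt//.
have mU := measurable_coord_sqr U nu.
pose f i (z : 'cV[R]_d * 'cV[R]_d) := (U *m (z.1 - nu)) i 0.
pose g i (z : 'cV[R]_d * 'cV[R]_d) := (U *m (z.2 - nu)) i 0.
have mf i : measurable_fun setT (f i) by exact: (measurableT_comp (mU i) measurable_fst).
have mg i : measurable_fun setT (g i) by exact: (measurableT_comp (mU i) measurable_snd).
have -> : (\int[pi]_z (sqnorm2 (z.1 - z.2))%:E =
    \sum_i \int[pi]_z ((f i z - g i z) ^+ 2)%:E)%E.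
  rewrite -ge0_integral_sum//; last 2 first.
  - by move=> i; apply/measurable_EFinP; apply: measurable_funX; exact: measurable_funB.
  - by move=> i z _; rewrite lee_fin sqr_ge0.
  apply: eq_integral => z _; rewrite sumEFin; congr _%:E.
  rewrite -(sqnorm2_orthogonal (z.1 - z.2) UU); apply: eq_bigr => i _.
  rewrite /f /g -[_ - (U *m _) i 0]/(_ + - _).
  have -> : z.1 - z.2 = (z.1 - nu) - (z.2 - nu) by rewrite opprB addrA subrK.
  by rewrite mulmxBr [in LHS]mxE [X in _ + X]mxE.
rewrite /T -sumEFin; apply: lee_sum => i _.
apply: L2_distance_ge => //.
- rewrite (integral_coupling1 (f := fun z => (((U *m (z - nu)) i 0) ^+ 2)%:E) pi_c)//.
    by apply/measurable_EFinP; exact: measurable_funX.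
  by move=> z; rewrite lee_fin sqr_ge0.
- rewrite (integral_coupling2 (f := fun z => (((U *m (z - nu)) i 0) ^+ 2)%:E) pi_c)//.
    by apply/measurable_EFinP; exact: measurable_funX.
  by move=> z; rewrite lee_fin sqr_ge0.
Qed.

End coupling_bounds.

(** * Worst case of an affine estimator over the ball *)

Section worst_case.
Variables (R : realType) (n m : nat) (mux : 'cV[R]_n) (muy : 'cV[R]_m).
Variables (Sigma : 'M[R]_(n + m)) (rho : R).
Hypotheses (n_ge1 : (1 <= n)%N) (rho_ge0 : 0 <= rho) (Sigma_posdef : posdef Sigma).

Let mu := col_mx mux muy.
Let PP := normal_ball (normal_law mu Sigma) rho.

Definition affine_estimator (A : 'M[R]_(n, m)) (y : 'cV[R]_m) : 'cV[R]_n :=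
  A *m (y - muy) + mux.

Lemma estimators_affine A : estimators (affine_estimator A).
Proof.
apply: measurable_fun_mx => i j; under eq_fun do rewrite mxE.
apply: measurable_funD => //.
apply: (measurableT_comp (measurable_entry i j)).
apply: (measurableT_comp (measurable_mulmx A)).
apply: measurable_fun_mx => k l; under eq_fun do rewrite !mxE.
by apply: measurable_funD => //; exact: measurable_entry.
Qed.

Lemma affine_error A (z : 'cV[R]_(n + m)) :
  usubmx z - affine_estimator A (dsubmx z) = errmx A *m (z - mu).
Proof.
rewrite -{3}(vsubmxK z) /mu opp_col_mx add_col_mx mul_row_col mul1mx mulNmx.
by rewrite /affine_estimator opprD addrA addrAC.
Qed.

Lemma worst_mse_affine A (c : R) :
  (forall S, D_feasible Sigma rho S -> \tr (errmx A *m S *m (errmx A)^T) <= c) ->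
  (worst_mse PP (affine_estimator A) <= c%:E)%E.
Proof.
move=> tr_le; apply: ge_ereal_sup => _ [Q [[nu [S [S0 QE]]] W2Q] <-].
set B := errmx A in tr_le.
rewrite mseE; under eq_integral do rewrite affine_error.
have [U [l [UU BE l0]]] : exists (U : 'M[R]_(n + m)) (l : 'rV[R]_(n + m)),
    [/\ U *m U^T = 1%:M, B^T *m B = U^T *m diag_mx l *m U & forall i, 0 <= l 0 i].
  by apply: psd_spectral; rewrite -{2}(trmxK B); exact: psd_gram.
have sqE (w : 'cV[R]_(n + m)) : sqnorm2 (B *m w) = \sum_i l 0 i * ((U *m w) i 0) ^+ 2.
  rewrite sqnorm2E trmx_mul mulmxA -(mulmxA w^T) BE !mulmxA -trmx_mul -mulmxA.
  rewrite -mulmxA mxE; apply: eq_bigr => i _.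
  by rewrite mul_diag_mx [X in X * _]mxE [X in _ * X]mxE mulrCA -expr2.
have Qint (f : 'cV[R]_(n + m) -> \bar R) :
    (\int[Q]_z f z = \int[normal_law nu S]_z f z)%E.
  by apply: eq_measure_integral => V mV _; exact: QE.
have mU := measurable_coord_sqr U mu.
have mU2 i : measurable_fun setT (fun z : 'cV[R]_(n + m) => (((U *m (z - mu)) i 0) ^+ 2)%:E).
  by apply/measurable_EFinP; exact: measurable_funX.
have coordE i (w : 'cV[R]_(n + m)) : ((U *m w) i 0) ^+ 2 = sqnorm2 (row i U *m w).
  by rewrite -row_mul /sqnorm2 big_ord1 [in RHS]mxE.
(* Second moments are centred at [mu], not at the mean [nu] of [Q], so the bias is included in
   [a]. *)
pose a i := Num.sqrt (fine (\int[Q]_z (((U *m (z - mu)) i 0) ^+ 2)%:E)%E).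
have Qa i : (\int[Q]_z (((U *m (z - mu)) i 0) ^+ 2)%:E = (a i ^+ 2)%:E)%E.
  have int0 : (0 <= \int[Q]_z (((U *m (z - mu)) i 0) ^+ 2)%:E)%E.
    by apply: integral_ge0 => z _; rewrite lee_fin sqr_ge0.
  rewrite /a sqr_sqrtr ?fine_ge0// fineK// ge0_fin_numE// Qint.
  under eq_integral do rewrite coordE.
  exact: normal_law_sqnorm2_lty.
pose s i := Num.sqrt ((U *m Sigma *m U^T) i i).
have Sigma0 := posdef_psd Sigma_posdef.
have Ps i : (\int[normal_law mu Sigma]_z (((U *m (z - mu)) i 0) ^+ 2)%:E = (s i ^+ 2)%:E)%E.
  under eq_integral do rewrite coordE.
  rewrite normal_law_sqnorm2// /s sqr_sqrtr; last exact/psd_diag_ge0/psd_congr.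
  congr _%:E; rewrite -row_mul /mxtrace big_ord1 !mxE.
  by apply: eq_bigr => k _; rewrite !mxE.
have s_gt0 i : 0 < s i by rewrite sqrtr_gt0; exact: posdef_orthogonal_diag_gt0.
pose t : 'rV[R]_(n + m) := \row_i Num.max (a i - s i) 0.
have t0 i : 0 <= t 0 i by rewrite mxE le_max lexx orbT.
have t_le : \sum_i t 0 i ^+ 2 <= rho ^+ 2.
  under eq_bigr do rewrite mxE.
  by apply: W2_ge UU _ s_gt0 Qa Ps rho_ge0 W2Q => i; exact: sqrtr_ge0.
have [S' FS' trS'] := D_feasible_spectral n_ge1 Sigma_posdef UU t0 t_le.
have -> : (\int[Q]_z (sqnorm2 (B *m (z - mu)))%:E = (\sum_i l 0 i * a i ^+ 2)%:E)%E.
  under eq_integral do rewrite sqE -sumEFin.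
  rewrite ge0_integral_sum//; last 2 first.
  - by move=> i; under eq_fun do rewrite EFinM; exact: emeasurable_funM.
  - by move=> i z _; rewrite lee_fin mulr_ge0// sqr_ge0.
  rewrite -sumEFin; apply: eq_bigr => i _.
  under eq_integral do rewrite EFinM.
  rewrite ge0_integralZl//; first by rewrite Qa EFinM.
    by move=> z _; rewrite lee_fin sqr_ge0.
  by rewrite lee_fin.
rewrite lee_fin; apply: le_trans (tr_le _ FS').
(* Termwise comparison: [a_i <= s_i + t_i] by the choice of [t]. *)
rewrite mxtrace_mulC mulmxA BE trS'; apply: ler_sum => i _; rewrite ler_wpM2l//.
rewrite ler_sqr ?nnegrE ?sqrtr_ge0 ?addr_ge0 ?sqrtr_ge0//.
by rewrite -lerBlDl [t 0 i]mxE le_max lexx.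
Qed.

End worst_case.

(** * The minimax theorem *)

Section minimax.
Variables (R : realType) (n m : nat) (mux : 'cV[R]_n) (muy : 'cV[R]_m).
Variables (Sigma : 'M[R]_(n + m)) (rho : R).
Hypotheses (n_ge1 : (1 <= n)%N) (rho_ge0 : 0 <= rho) (Sigma_posdef : posdef Sigma).

Let mu := col_mx mux muy.
Let PP := normal_ball (normal_law mu Sigma) rho.
Let F := D_feasible Sigma rho.
Let K := 2 * rho ^+ 2 + 2 * \tr Sigma.
(** The second-order constant of [D_first_order]. *)
Let C := K ^+ 3 / lambda_min Sigma ^+ 2.

Let C_ge0 : 0 <= C.
Proof.
have tr0 := psd_tr_ge0 (posdef_psd Sigma_posdef).
by rewrite divr_ge0 ?sqr_ge0// exprn_ge0// addr_ge0// mulr_ge0// sqr_ge0.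
Qed.

Lemma D_feasible_Sigma : F Sigma.
Proof.
have := @D_feasible_dilation R n m Sigma rho n_ge1 Sigma_posdef 1%:M.
rewrite /loewner_ge subrr mul1mx mulmx1 !mul0mx linear0; apply.
  exact: psd0.
exact: sqr_ge0.
Qed.

Lemma normal_ball_D_feasible S : F S -> PP (normal_law mu S).
Proof.
move=> FS; have Spd := D_feasible_posdef n_ge1 Sigma_posdef FS.
split; first by exists mu, S; split; first exact: posdef_psd.
apply: W2_normal_law_le => //.
by have /(D_feasibleP _ n_ge1 Sigma_posdef)[] := FS.
Qed.

Lemma D_objective_le_worst_mse S psi : F S -> estimators psi ->
  ((D_objective S)%:E <= worst_mse PP psi)%E.
Proof.
move=> FS mpsi.
apply: le_ereal_sup_tmp; exists (mse (normal_law mu S) psi).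
  by exists (normal_law mu S) => //; exact: normal_ball_D_feasible.
apply: mse_normal_law_ge => //; first exact: (D_feasible_posdef n_ge1 Sigma_posdef FS).
exact: (D_feasible_unit n_ge1 Sigma_posdef FS).
Qed.

Lemma D_value_le_minimax : (D_value Sigma rho <= minimax_value PP)%E.
Proof.
apply: ge_ereal_sup => _ [S FS <-]; apply: le_ereal_inf_tmp => _ [psi mpsi <-].
exact: D_objective_le_worst_mse.
Qed.

(** Here [e] is the step length along the segment from [S0]; the two errors [eta / e] and [e C] of
    [D_first_order] are each at most [eps]. *)
Lemma worst_mse_near_optimal S0 (eta eps : R) : F S0 -> 0 < eps -> 0 <= eta ->
  (forall S, F S -> D_objective S <= D_objective S0 + eta) ->
  forall e, 0 < e -> e <= 1 -> eta <= e * eps -> e * C <= eps ->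
  (worst_mse PP (affine_estimator mux muy (gain S0)) <=
    (D_objective S0 + 2 * eps)%:E)%E.
Proof.
move=> F0 eps0 eta0 opt e e0 e1 eta_le eC_le.
apply: worst_mse_affine => // S FS.
apply: le_trans (D_first_order n_ge1 Sigma_posdef F0 FS opt e0 e1) _.
have : eta / e <= eps by rewrite ler_pdivrMr// mulrC.
rewrite -/K -/C; lra.
Qed.

Let small (eps : R) : 0 < eps -> exists e : R, [/\ 0 < e, e <= 1 & e * C <= eps].
Proof.
(* Adding one keeps the denominator positive when [C] is zero. *)
move=> eps0; exists (Num.min 1 (eps / (C + 1))).
have C1 : 0 < C + 1 by rewrite ltr_wpDl.
split; first by rewrite lt_min ltr01 divr_gt0.
  by rewrite ge_min lexx.
apply: (@le_trans _ _ (eps / (C + 1) * C)).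
  by rewrite ler_wpM2r// ge_min lexx orbT.
by rewrite mulrAC ler_pdivrMr// ler_pM2l// lerDl.
Qed.

Lemma worst_mse_optimal S0 : D_optimal Sigma rho S0 ->
  (worst_mse PP (affine_estimator mux muy (gain S0)) <= (D_objective S0)%:E)%E.
Proof.
move=> [F0 opt]; apply/lee_addgt0Pr => eps eps0.
have eps20 : 0 < eps / 2 by rewrite divr_gt0.
have [e [e0 e1 eC]] := small eps20.
have := @worst_mse_near_optimal S0 0 (eps / 2) F0 eps20 (lexx 0) _ e e0 e1 _ eC.
rewrite (_ : 2 * (eps / 2) = eps); last by field.
rewrite -EFinD; apply; first by move=> S FS; rewrite addr0; exact: opt.
by rewrite mulr_ge0// ltW.
Qed.

Lemma minimax_le_D_value : (minimax_value PP <= D_value Sigma rho)%E.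
Proof.
apply/lee_addgt0Pr => eps eps0.
have eps20 : 0 < eps / 2 by rewrite divr_gt0.
have [e [e0 e1 eC]] := small eps20.
pose V := D_value Sigma rho.
have V_ub S : F S -> ((D_objective S)%:E <= V)%E.
  by move=> FS; apply: ereal_sup_ubound; exists S.
have V_le : (V <= K%:E)%E.
  apply: ge_ereal_sup => _ [S FS <-]; rewrite lee_fin.
  apply: le_trans (D_objective_tr n_ge1 Sigma_posdef FS) _.
  exact: (D_feasible_tr n_ge1 Sigma_posdef FS).
have V_fin : V \is a fin_num.
  rewrite fin_numElt (le_lt_trans V_le) ?ltry// andbT.
  by apply: lt_le_trans (V_ub _ D_feasible_Sigma); rewrite ltNyr.
(* The tolerance is fixed after the step length, so that [eta / e] is [eps / 2]; finiteness of [V]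
   then supplies a matrix within [eta] of the supremum. *)
pose eta := e * (eps / 2).
have eta0 : 0 < eta by rewrite mulr_gt0.
have [_ [S0 F0 <-] V_lt] := ub_ereal_sup_adherent eta0 V_fin.
have S0_opt S : F S -> D_objective S <= D_objective S0 + eta.
  move=> FS; rewrite -lee_fin (le_trans (V_ub S FS))// EFinD -leeBlDr//.
  exact: ltW.
have worst := worst_mse_near_optimal F0 eps20 (ltW eta0) S0_opt e0 e1 (lexx _) eC.
apply: (@le_trans _ _ (worst_mse PP (affine_estimator mux muy (gain S0)))).
  apply: ereal_inf_lbound; exists (affine_estimator mux muy (gain S0)) => //.
  exact: estimators_affine.
apply: le_trans worst _; rewrite (_ : 2 * (eps / 2) = eps); last by field.
by rewrite EFinD leeD2r// V_ub.
Qed.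

End minimax.

Theorem theorem2p5 (R : realType) (n m : nat) (mux : 'cV[R]_n) (muy : 'cV[R]_m)
    (Sigma : 'M[R]_(n + m)) (rho : R)
    (n_ge1 : (1 <= n)%N) (m_ge1 : (1 <= m)%N) (rho_ge0 : 0 <= rho)
    (Sigma_posdef : posdef Sigma) :
  let mu := col_mx mux muy in
  let PP := normal_ball (normal_law mu Sigma) rho in
  [/\ convex_set (D_feasible Sigma rho),
      concave_function (D_feasible Sigma rho) (@D_objective R n m),
      minimax_value PP = D_value Sigma rho &
      forall S : 'M[R]_(n + m), D_optimal Sigma rho S ->
        dr_mmse_estimator PP
          (fun y => ursubmx S *m invmx (drsubmx S) *m (y - muy) + mux)
        /\ least_favorable_prior PP (normal_law mu S)].
Proof.
move=> mu PP; split.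
- exact: convex_D_feasible.
- exact: concave_D_objective.
- apply/eqP; rewrite eq_le minimax_le_D_value// D_value_le_minimax//.
- move=> S opt; have [FS _] := opt.
  have est := estimators_affine mux muy (gain S).
  have worst := worst_mse_optimal mux muy n_ge1 rho_ge0 Sigma_posdef opt.
  split; [split=> [//|phi mphi]|split=> [|Q PQ]].
  (* The objective at [S] separates the worst case of the affine estimator from that of any
     competitor. *)
  + apply: le_trans worst _.
    exact: D_objective_le_worst_mse.
  + exact: normal_ball_D_feasible.
  (* Saddle point: the affine estimator is a competitor under [Q], with error at most the objective
     at [S], and no estimator does better than that under [normal_law mu S]. *)
  + apply: (@le_trans _ _ (D_objective S)%:E).
      apply: le_trans worst.
      apply: ge_ereal_inf; exists (mse Q (affine_estimator mux muy (gain S))).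
        by exists (affine_estimator mux muy (gain S)).
      by apply: ereal_sup_ubound; exists Q.
    apply: le_ereal_inf_tmp => _ [psi mpsi <-]; apply: mse_normal_law_ge => //.
      exact: (D_feasible_posdef n_ge1 Sigma_posdef FS).
    exact: (D_feasible_unit n_ge1 Sigma_posdef FS).
Qed.
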